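(* Let $L(z)$ and $m(z)$ be complex Laurent polynomials such that the coefficient of the term $1/z$ in $m(z)$ is distinct from zero and $$\int_{S^1}L^i(z)m(z)\,dz=0$$ for all $i\ge i_0$, where $i_0\ge0$. Then $L(z)$ is either a polynomial in $z$ or a polynomial in $1/z$.
   Context: $S^1$ is the unit circle in $\mathbb C$. A Laurent polynomial is an element of $\mathbb C[z,z^{-1}]$. *)

(* Defs.v *)
From HB Require Import structures.
From mathcomp Require Import all_boot all_order all_algebra.
From mathcomp Require Import finmap.
From mathcomp Require Import complex.
From mathcomp Require Import all_classical all_reals all_analysis.

Set Implicit Arguments.
Unset Strict Implicit.
Unset Printing Implicit Defensive.

Import Order.TTheory GRing.Theory Num.Theory.

Local Open Scope classical_set_scope.
Local Open Scope complex_scope.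
Local Open Scope ring_scope.

(* An element of C[z, 1/z], given by its finitely supported family of
   coefficients: [L n] is the coefficient of z ^ n. *)
Definition laurent (R : realType) := {fsfun int -> R[i] with 0}.

(* Since [0^-1 = 0] in MathComp, the value is only meaningful for [z != 0]. *)
Definition laurent_eval (R : realType) (L : laurent R) (z : R[i]) : R[i] :=
  \sum_(n <- finsupp L) L n * z ^ n.

Definition polynomial_in_z (R : realType) (L : laurent R) : Prop :=
  exists p : {poly R[i]}, forall z : R[i], z != 0 ->
    laurent_eval L z = p.[z].

Definition polynomial_in_inv_z (R : realType) (L : laurent R) : Prop :=
  exists p : {poly R[i]}, forall z : R[i], z != 0 ->
    laurent_eval L z = p.[z^-1].

Definition expi (R : realType) (t : R) : R[i] := cos t +i* sin t.

(* The contour integral of f over the positively oriented unit circle, i.e. the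
   integral of f (e^(it)) d(e^(it)) = f (e^(it)) i e^(it) dt for 0 <= t <= 2 pi,
   taken componentwise. It is only meaningful for integrable integrands. *)
Definition circle_integral (R : realType) (f : R[i] -> R[i]) : R[i] :=
  let g (t : R) : R[i] := f (expi t) * ('i%C * expi t) in
  Rintegral (@lebesgue_measure R) `[0, pi *+ 2] (fun t => complex.Re (g t)) +i*
  Rintegral (@lebesgue_measure R) `[0, pi *+ 2] (fun t => complex.Im (g t)).

(* Main.v *)
Require Import Defs.
From HB Require Import structures.
From mathcomp Require Import all_boot all_order all_algebra.
From mathcomp Require Import all_fingroup all_solvable all_field.
From mathcomp Require Import finmap.
From mathcomp Require Import complex.
From mathcomp Require Import all_classical all_reals all_analysis.
From mathcomp Require Import ring zify.

(** Write L = q / z^k and suppose that 0 < k < n = deg q, i.e. that L has poles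
    both at 0 and at infinity. For a large parameter T, let x_1, ..., x_n be the
    solutions of L(x) = T, i.e. the roots of f = q - T x^k. The generating
    function of the moments of L against m is the contour integral of
    m / (T - L), which is, up to a polynomial in T, minus the sum of
    y_i = w(x_i) / f'(x_i) over the roots in the unit disc, for some polynomial
    w(x, T) of degree < n in x. When almost all moments vanish, this partial sum
    of the y_i is therefore an element of C(T). But the y_i are conjugate over
    C(T), since x_i is transcendental over C and T = L(x_i); averaging over the
    Galois group shows that the partial sum is a rational multiple of the full
    sum of the y_i, which is a polynomial in T because the leading coefficient
    of f is constant. Hence no negative power of T occurs, and all moments
    vanish, including the 0-th one, the coefficient of 1/z in m.

    The splitting field of f over C(T) and the complex roots of f at T = N are
    compared through specialization maps that are ring morphisms for all large
    integers N. Contour integrals of rational functions are replaced with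
    averages over the M-th roots of unity, with M tending to infinity. *)

Set Implicit Arguments.
Unset Strict Implicit.
Unset Printing Implicit Defensive.

Import Order.TTheory GRing.Theory Num.Theory.
Import numFieldNormedType.Exports.

Local Open Scope quotient_scope.
Local Open Scope classical_set_scope.
Local Open Scope ring_scope.

Local Notation tofrac := (@FracField.tofrac _).

(** * Splitting fields and fractions *)

(** Irreducibility is not decidable over an arbitrary field, so the factor is found classically. The
    informative form allows the recursive field construction below. *)
Lemma irreducible_factor (F : fieldType) (p : {poly F}) :
  (1 < size p)%N -> {r : {poly F} | r %| p & irreducible_poly r}.
Proof.
move=> p_gt1; apply/cid2; move: {2}(size p) (leqnn (size p)) => n.
elim: n p p_gt1 => [|n IHn] p p_gt1 lepn.
  by rewrite leqNgt (leq_trans _ p_gt1) in lepn.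
have [irr_p|] := pselect (irreducible_poly p); first by exists p.
move=> red_p; apply: contrapT => no_r; apply: red_p; split=> // q q_neq1 q_dv_p.
have p_neq0 : p != 0 by rewrite -size_poly_gt0 ltnW.
have q_neq0 : q != 0 by apply: contraTneq q_dv_p => ->; rewrite dvd0p.
rewrite -dvdp_size_eqp // eqn_leq dvdp_leq //= leqNgt.
apply/negP => lt_qp; apply: no_r.
have q_gt1 : (1 < size q)%N by rewrite ltn_neqAle eq_sym q_neq1 size_poly_gt0.
have [r r_dv_q irr_r] := IHn q q_gt1 (leq_trans lt_qp lepn).
by exists r => //; apply: dvdp_trans q_dv_p.
Qed.

(** Adjoin one root of an irreducible factor, split the cofactor over the larger field K by
    induction on the size, and view the resulting extension of K as one of F. *)
Lemma splitting_extension (F : fieldType) (p : {poly F}) : p != 0 ->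
  {L : fieldExtType F & {zs : seq L |
    map_poly (in_alg L) p %= \prod_(z <- zs) ('X - z%:P)}}.
Proof.
have mapXsubC (K K' : fieldType) (g : {rmorphism K -> K'}) x :
    map_poly g ('X - x%:P) = 'X - (g x)%:P.
  by rewrite rmorphB /= map_polyX map_polyC.
move: {2}_.+1 (ltnSn (size p)) => n; elim: n => // n IHn in F p * => lbn nz_p.
have [Cp|C'p] := leqP (size p) 1.
  exists F^o, [::].
  by rewrite big_nil -size_poly_eq1 size_map_poly eqn_leq Cp size_poly_gt0.
have [r r_dv_p irr_r] := irreducible_factor C'p.
have [K _ [x rx0 _]] := irredp_FAdjoin irr_r.
have {r irr_r rx0 r_dv_p} /factor_theorem/sig_eqW[q Dp] : root (map_poly (in_alg K) p) x.
  by rewrite -(divpK r_dv_p) rmorphM /= rootM rx0 orbT.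
have Dszp : size p = size (q * ('X - x%:P)) by rewrite -Dp size_map_poly.
have nz_q : q != 0.
  by move: nz_p; rewrite -size_poly_eq0 Dszp size_poly_eq0 mulf_eq0 => /norP[].
have [L [zs Dq]] : {L : fieldExtType K & {zs : seq L |
    map_poly (in_alg L) q %= \prod_(z <- zs) ('X - z%:P)}}.
  apply: (IHn K q) => //.
  by rewrite ltnS Dszp size_mul ?polyXsubC_eq0 ?size_XsubC ?addn2 in lbn.
suffices: {zs : seq L | map_poly (in_alg L) (map_poly (in_alg K) p) %=
    \prod_(z <- zs) ('X - z%:P)}.
  rewrite -map_poly_comp.
  rewrite -(eq_map_poly (fun a : F => baseField_scaleE a 1)).
  by exists (baseFieldType L).
exists (x%:A :: zs); rewrite big_cons; set rhs := _ * _.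
by rewrite Dp mulrC rmorphM /= mapXsubC /= eqp_mull.
Qed.

Lemma splitting_field_exists (F : fieldType) (p : {poly F}) : p != 0 ->
  {L : splittingFieldType F & {zs : seq L |
    map_poly (in_alg L) p %= \prod_(z <- zs) ('X - z%:P)}}.
Proof.
have mapXsubC (K K' : fieldType) (g : {rmorphism K -> K'}) x :
    map_poly g ('X - x%:P) = 'X - (g x)%:P.
  by rewrite rmorphB /= map_polyX map_polyC.
(* L may be larger than what the roots generate; the splitting field is the subfield [Lp] generated
   by them, to which the roots and the factorization are pulled back. *)
move=> nz_p; have [L [ys Dp]] := splitting_extension nz_p.
pose Lp : fieldExtType F := subvs_of <<1 & ys>>; pose toL := linfun (vsval : Lp -> L).
have [zs Dys] : {zs : seq Lp | map toL zs = ys}.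
  exists (map (vsproj _) ys); rewrite -map_comp map_id_in // => y ys_y.
  by rewrite /= lfunE /= vsprojK ?seqv_sub_adjoin.
have splitp : map_poly (in_alg Lp) p %= \prod_(z <- zs) ('X - z%:P).
  set lhs := (lhs in lhs %= _); set rhs := (rhs in _ %= rhs).
  suffices: map_poly toL lhs %= map_poly toL rhs by rewrite eqp_map.
  rewrite -Dys big_map in Dp; apply: etrans Dp; apply: congr2.
    by rewrite -map_poly_comp; apply/eq_map_poly=> x; apply: rmorph_alg.
  by rewrite rmorph_prod; apply/eq_bigr=> z _; apply: mapXsubC.
have splitL : SplittingField.axiom Lp.
  exists (map_poly (in_alg Lp) p); first by apply/polyOver1P; exists p.
  exists zs => //; set Lzs := LHS; pose Lys := (toL @: Lzs)%VS; apply/vspaceP=> u.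
  have: val u \in Lys by rewrite /Lys aimg_adjoin_seq aimg1 Dys (valP u).
  by case/memv_imgP=> v Lzs_v; rewrite memvf lfunE => /val_inj->.
pose M := FieldExt_isSplittingField.Build F Lp splitL.
by exists (HB.pack_for (splittingFieldType F) Lp M), zs.
Qed.

Lemma tofrac_quotient (A : idomainType) (c : {fraction A}) :
  exists a b, b != 0 /\ tofrac b * c = tofrac a.
Proof.
elim/quotW: c => c; exists (frac c).1, (frac c).2; split; first exact: denom_ratioP.
unlock FracField.tofrac; rewrite -[LHS]FracField.pi_mul.
apply/eqmodP/eqP; rewrite /= /FracField.mulf /=.
by rewrite !numden_Ratio ?(mul1r, mulf_neq0, oner_eq0, denom_ratioP) // mulr1.
Qed.

Lemma clear_denominators (A : idomainType) (p : {poly {fraction A}}) :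
  exists2 d : A, d != 0 & exists u : {poly A},
    tofrac d *: p = map_poly tofrac u.
Proof.
elim/poly_ind: p => [|p c [d d_neq0 [u Du]]].
  by exists 1; [exact: oner_neq0 | exists 0; rewrite scaler0 rmorph0].
have [a [b [b_neq0 Dc]]] := tofrac_quotient c.
exists (d * b); first exact: mulf_neq0.
exists (b *: u * 'X + (d * a)%:P).
rewrite [RHS]rmorphD /= [map_poly _ (_ * _)]rmorphM /=.
rewrite map_polyX map_polyC map_polyZ /= -Du ![tofrac (_ * _)]rmorphM /= -Dc.
by rewrite scalerDr -[_ *: c%:P]mul_polyC -polyCM mulrA scalerA -scalerAl mulrC.
Qed.

(** * The solutions of q(x) / x^k = T *)

Definition ratfrac (C : fieldType) : fieldType := {fraction {poly C}}.

Definition of_poly (C : fieldType) (E : fieldExtType (ratfrac C)) : {poly C} -> E :=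
  in_alg E \o tofrac.

HB.instance Definition _ (C : fieldType) (E : fieldExtType (ratfrac C)) :=
  GRing.RMorphism.copy (@of_poly C E) (in_alg E \o @FracField.tofrac {poly C}).

Lemma of_poly_eq0 (C : fieldType) (E : fieldExtType (ratfrac C)) (p : {poly C}) :
  (of_poly E p == 0) = (p == 0).
Proof. by rewrite [LHS](fmorph_eq0 (in_alg E)) tofrac_eq0. Qed.

(* The coefficients are polynomials in the parameter T, which is the inner 'X. *)
Definition level_poly (C : fieldType) (q : {poly C}) (k : nat) : {poly {poly C}} :=
  q^:P - 'X%:P * 'X^k.

Section Roots.
Variables (C : closedFieldType) (E : fieldExtType (ratfrac C)).
Variables (q : {poly C}) (k : nat).
Hypotheses (q0 : q`_0 != 0) (k_gt0 : (0 < k)%N).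
Let T : E := of_poly E 'X.
Let evC (P : {poly C}) (x : E) : E := (map_poly (of_poly E) P^:P).[x].
Let evP (u : {poly {poly C}}) (x : E) : E := (map_poly (of_poly E) u).[x].

Let evP_level x : evP (level_poly q k) x = evC q x - T * x ^+ k.
Proof.
by rewrite /evP rmorphB rmorphM /= map_polyC map_polyXn !hornerE.
Qed.

Let level_root x : evP (level_poly q k) x = 0 -> evC q x = T * x ^+ k.
Proof. by move=> fx; apply/eqP; rewrite -subr_eq0 -evP_level fx. Qed.

(** Since C is algebraically closed, P splits over C, so a root x of P would be a constant c.
    Comparing coefficients of T in [q(c) = T c^k] gives [c = 0] and [q(0) = 0], against [q0]. *)
Lemma level_root_transcendental x P :
  evP (level_poly q k) x = 0 -> evC P x = 0 -> P = 0.
Proof.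
have evCM P1 P2 : evC (P1 * P2) x = evC P1 x * evC P2 x.
  by rewrite /evC !rmorphM /= hornerM.
move=> /level_root qx Px0; apply/eqP/negPn/negP => P_neq0.
have [r DP] := closed_field_poly_normal P.
have /eqP : evC P x = 0 by [].
rewrite DP /evC map_polyZ /= map_polyZ /= hornerZ mulf_eq0 of_poly_eq0.
rewrite polyC_eq0 lead_coef_eq0 (negPf P_neq0) /=.
rewrite !rmorph_prod horner_prod /= prodf_seq_eq0 => /hasP[c _].
rewrite rmorphB /= map_polyX map_polyC /= rmorphB /= map_polyX map_polyC /=.
rewrite !hornerE subr_eq0 => /eqP Dx.
move: qx; rewrite Dx /evC horner_map /= -rmorphXn -rmorphM /=.
move/eqP; rewrite -subr_eq0 -rmorphB of_poly_eq0 horner_map /= => /eqP/polyP eqc.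
have := eqc 1%N; rewrite coefB coefC -rmorphXn coefXM coefC /= sub0r coef0.
move/eqP; rewrite oppr_eq0 expf_eq0 k_gt0 => /eqP c0.
have := eqc 0%N; rewrite coefB coefC -rmorphXn coefXM coefC /= subr0 coef0 c0.
by move/eqP; rewrite horner_coef0 (negPf q0).
Qed.

Let level_root_neq0 x : evP (level_poly q k) x = 0 -> x != 0.
Proof.
move/level_root => qx; apply/eqP => x0; move: qx; rewrite x0 expr0n gtn_eqF //= mulr0.
rewrite /evC horner_coef0 coef_map coef_map /= => /eqP.
by rewrite of_poly_eq0 polyC_eq0 (negPf q0).
Qed.

(** This is [x^(k D) c(q(x) / x^k)]: the substitution of [q(x) / x^k] for T with denominators
    cleared. *)
Let hom (D : nat) (c : {poly C}) : {poly C} :=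
  \sum_(b < D) c`_b *: (q ^+ b * 'X^(k * (D - b))).

Let evC_hom (D : nat) (c : {poly C}) x :
  evP (level_poly q k) x = 0 -> (size c <= D)%N ->
  evC (hom D c) x = x ^+ (k * D) * of_poly E c.
Proof.
move=> /level_root qx leD; rewrite /evC /hom !rmorph_sum horner_sum /=.
have -> : of_poly E c = \sum_(b < D) of_poly E (c`_b)%:P * T ^+ b.
  have {1}-> : c = \poly_(b < D) c`_b.
    apply/polyP => b; rewrite coef_poly; case: ltnP => // leDb.
    by rewrite nth_default ?(leq_trans leD).
  rewrite poly_def rmorph_sum /=; apply: eq_bigr => b _.
  by rewrite -mul_polyC rmorphM rmorphXn.
rewrite mulr_sumr; apply: eq_bigr => b _.
rewrite !map_polyZ /= !rmorphM !rmorphXn /= !map_polyX hornerZ !hornerE /=.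
rewrite -/(evC q x) qx exprMn -exprM.
have -> : (k * D = k * b + k * (D - b))%N.
  by rewrite -mulnDr subnKC // (ltnW (ltn_ord b)).
by rewrite exprD; ring.
Qed.

(* Substituting T = q(x) / x^k turns a relation between T and x into a
   polynomial relation satisfied by x alone, which must be trivial. *)
Lemma level_roots_conjugate u x y :
    evP (level_poly q k) x = 0 -> evP (level_poly q k) y = 0 ->
  evP u x = 0 -> evP u y = 0.
Proof.
(* D bounds the degrees in T of all coefficients of u, so that a single power [x^(k D)] clears every
   denominator. *)
move=> fx fy ux; pose D := \max_(a < size u) size (u`_a)%R.
pose P := \sum_(a < size u) hom D u`_a * 'X^a.
have evP_hom z : evP (level_poly q k) z = 0 -> evC P z = z ^+ (k * D) * evP u z.
  move=> fz; rewrite /evC /P !rmorph_sum horner_sum /=.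
  have -> : evP u z = \sum_(a < size u) (map_poly (of_poly E) (u`_a *: 'X^a)).[z].
    by rewrite -horner_sum -rmorph_sum -poly_def coefK.
  rewrite mulr_sumr.
  apply: eq_bigr => a _; rewrite !rmorphM /= hornerM !map_polyXn hornerXn.
  rewrite -/(evC _ z) evC_hom //; last exact: (leq_bigmax a).
  by rewrite map_polyZ map_polyXn hornerZ hornerXn mulrA.
have P0 : P = 0 by apply: (level_root_transcendental fx); rewrite evP_hom // ux mulr0.
have /eqP := evP_hom y fy; rewrite P0 /evC !rmorph0 horner0 eq_sym mulf_eq0.
by rewrite expf_eq0 (negPf (level_root_neq0 fy)) andbF => /eqP.
Qed.

(** Using [T x^k = q(x)], the product [x f'(x)] equals [x q'(x) - k q(x)]. By transcendence of x its
    vanishing would force [X q' - k q = 0], but the coefficient of degree n there is [(n - k)] times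
    the leading one of q. *)
Lemma deriv_level_root_neq0 x : [pchar C] =i pred0 -> (k < (size q).-1)%N ->
  evP (level_poly q k) x = 0 -> evP (level_poly q k)^`() x != 0.
Proof.
move=> pchar0 k_lt fx; apply/eqP => dfx.
have P0 : 'X * q^`() - q *+ k = 0.
  apply: (level_root_transcendental fx).
  rewrite /evC !rmorphB !rmorphMn !rmorphM /= !map_polyX hornerD hornerN hornerMn.
  rewrite hornerM hornerX -/(evC q x) -/(evC q^`() x) (level_root fx).
  rewrite -[RHS](mulr0 x) -dfx /evP /level_poly derivB deriv_map derivM derivC mul0r add0r.
  rewrite derivXn rmorphB rmorphM rmorphMn /= map_polyC map_polyXn !hornerE.
  rewrite -/T hornerMn hornerXn mulrBr -[(k)]prednK //=; congr (_ - _).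
  by rewrite exprS !mulrnAr mulrCA.
have /eqP : ('X * q^`() - q *+ k)`_((size q).-1) = 0 by rewrite P0 coef0.
have n_gt0 := leq_trans k_gt0 (ltnW k_lt).
rewrite coefB coefXM coefMn gtn_eqF // coef_deriv prednK // -mulrnBr ?(ltnW k_lt) //.
rewrite -mulr_natr mulf_eq0 -lead_coefE lead_coef_eq0 -size_poly_eq0.
rewrite gtn_eqF /=; last by case: (size q) n_gt0.
by move/pcharf0P: pchar0 => ->; rewrite subn_eq0 leqNgt k_lt.
Qed.

End Roots.

(** All [y i] have the same trace t. Both sums lie in the base field, where the trace is
    multiplication by the order of G, so they are in the ratio of [#|I|] to n. *)
Lemma conjugate_sum_average (F : fieldType) (E : splittingFieldType F)
    (n : nat) (y : 'I_n -> E) (I : {set 'I_n}) : [pchar F] =i pred0 ->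
    (forall i j, exists2 s, s \in 'Gal({:E} / 1)%g & s (y i) = y j) ->
    \sum_(i in I) y i \in 1%VS -> \sum_i y i \in 1%VS ->
  (\sum_(i in I) y i) *+ n = (\sum_i y i) *+ #|I|.
Proof.
move=> pchar0 conj_y I1 all1; pose G := 'Gal({:E} / 1)%g.
case: n y I conj_y I1 all1 => [|n] y I conj_y I1 all1.
  by rewrite mulr0n big_ord0 mul0rn.
pose tr z := \sum_(s in G) (s : gal_of {:E}) z.
have tr1 z : z \in 1%VS -> tr z = z *+ #|G|.
  by move=> z1; rewrite -sumr_const; apply: eq_bigr => s /fixed_gal ->; rewrite ?sub1v.
have tr_y i : tr (y i) = tr (y ord0).
  have [s Gs <-] := conj_y ord0 i; rewrite /tr [RHS](reindex_inj (mulgI s)) /=.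
  apply: eq_big => [t|t _]; first by rewrite groupMl.
  by rewrite galM ?memvf.
have tr_sum (J : {set 'I_n.+1}) : tr (\sum_(i in J) y i) = tr (y ord0) *+ #|J|.
  rewrite -sumr_const /tr; under eq_bigr do rewrite rmorph_sum.
  by rewrite exchange_big; apply: eq_bigr => i _; apply: tr_y.
have nG : (#|G|%:R : E) != 0.
  rewrite -(rmorph_nat (in_alg E)) fmorph_eq0.
  by move/pcharf0P: pchar0 => ->; rewrite -lt0n cardG_gt0.
apply: (mulIf nG); rewrite !mulr_natr -!mulrnA !(mulnC _ #|G|) !mulrnA -!tr1 //.
rewrite tr_sum (_ : \sum_i y i = \sum_(i in [set: 'I_n.+1]%SET) y i).
  by rewrite tr_sum cardsT card_ord -!mulrnA mulnC.
by apply: eq_bigl => i; rewrite inE.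
Qed.

Section Level.
Variables (C : closedFieldType) (q : {poly C}) (k : nat).
Hypothesis pchar0 : [pchar C] =i pred0.
Hypotheses (q0 : q`_0 != 0) (k_gt0 : (0 < k)%N) (k_lt : (k < (size q).-1)%N).
Let f := level_poly q k.

Lemma size_level_poly : size f = size q.
Proof.
rewrite /f /level_poly size_polyDl ?size_map_polyC //.
rewrite size_polyN mul_polyC (leq_ltn_trans (size_scale_leq _ _)) // size_polyXn.
by move: k_lt; case: (size q).
Qed.

Lemma lead_coef_level_poly : lead_coef f = (lead_coef q)%:P.
Proof.
rewrite /f /level_poly lead_coefDl ?lead_coef_map //.
rewrite size_map_polyC size_polyN mul_polyC (leq_ltn_trans (size_scale_leq _ _)) //.
by rewrite size_polyXn; move: k_lt; case: (size q).
Qed.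

Lemma level_splitting : exists (E : splittingFieldType (ratfrac C))
   (x : 'I_(size q).-1 -> E),
 [/\ injective x, forall i, (map_poly (of_poly E) f).[x i] = 0 &
   forall i j, exists2 s, s \in 'Gal({:E} / 1)%g & s (x i) = x j].
Proof.
have q_neq0 : q != 0 by apply: contraNneq q0 => ->; rewrite coef0.
have f_neq0 : f != 0 by rewrite -size_poly_eq0 size_level_poly size_poly_eq0.
pose fK : {poly ratfrac C} := map_poly tofrac f.
have fK_neq0 : fK != 0.
  rewrite -size_poly_eq0 size_map_poly_id0 ?size_poly_eq0 //.
  by rewrite tofrac_eq0 lead_coef_eq0.
have [E [xs Dxs]] := splitting_field_exists fK_neq0; exists E.
have map_fK : map_poly (in_alg E) fK = map_poly (of_poly E) f by rewrite -map_poly_comp.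
rewrite map_fK in Dxs.
have size_xs : size xs = (size q).-1.
  rewrite -size_level_poly -(size_map_poly_id0 (f := of_poly E)); last first.
    by rewrite of_poly_eq0 lead_coef_eq0.
  by rewrite (eqp_size Dxs) size_prod_XsubC.
have root_xs z : z \in xs -> (map_poly (of_poly E) f).[z] = 0.
  by move=> xs_z; apply/rootP; rewrite (eqp_root Dxs) root_prod_XsubC.
(* As f splits, a nonconstant common divisor of f and its derivative would have a root among [xs],
   which [deriv_level_root_neq0] excludes. *)
have uniq_xs : uniq xs.
  rewrite -separable_prod_XsubC -(eqp_separable Dxs).
  rewrite unlock; apply/coprimepP => d d_f d_df; move: (d_f); rewrite (eqp_dvdr _ Dxs).
  move=> /dvdp_prod_XsubC[m Dd]; rewrite -size_poly_eq1 (eqp_size Dd) size_prod_XsubC.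
  case Dm: (mask m xs) => [//|z zs].
  have dz : 'X - z%:P %| d.
    by rewrite dvdp_XsubCl (eqp_root Dd) root_prod_XsubC Dm mem_head.
  have /rootP fz : root (map_poly (of_poly E) f) z by rewrite -dvdp_XsubCl (dvdp_trans dz).
  have /negP[] := deriv_level_root_neq0 q0 k_gt0 pchar0 k_lt fz.
  by rewrite -rootE -dvdp_XsubCl -deriv_map (dvdp_trans dz).
have memx (i : 'I_(size q).-1) : xs`_i \in xs by rewrite mem_nth // size_xs.
exists (fun i => xs`_i); split=> [i j /eqP||i j].
- by rewrite nth_uniq ?size_xs // => /eqP/val_inj.
- by move=> i; apply/root_xs.
(* With denominators cleared, the minimal polynomial of one root is a relation between T and that
   root, hence satisfied by every other root. *)
have : root (minPoly 1 xs`_i) xs`_j.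
  have /polyOver1P[p Dp] := minPolyOver 1 xs`_i.
  have [d d_neq0 [u Du]] := clear_denominators p.
  have Du' : map_poly (of_poly E) u = (tofrac d)%:A *: minPoly 1 xs`_i.
    by rewrite Dp -(map_polyZ (in_alg E)) Du -map_poly_comp.
  have : (map_poly (of_poly E) u).[xs`_j] = 0.
    apply: (level_roots_conjugate q0 k_gt0 (root_xs _ (memx i)) (root_xs _ (memx j))).
    by rewrite Du' hornerZ minPolyxx mulr0.
  rewrite Du' hornerZ => /eqP; rewrite mulf_eq0 => /orP[|//].
  by rewrite (fmorph_eq0 (in_alg E)) tofrac_eq0 (negPf d_neq0).
apply: normalField_root_minPoly; rewrite ?sub1v ?memvf //.
exact: normalFieldf.
Qed.
End Level.

(** * Specialization T = N *)

Lemma filterS4 (T : Type) (F : set_system T) (FF : Filter F) (P Q R S U : set T) :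
    (forall x, P x -> Q x -> R x -> S x -> U x) ->
  F P -> F Q -> F R -> F S -> F U.
Proof.
move=> PQRS FP FQ FR FS.
apply: filterS (filterI (filterI FP FQ) (filterI FR FS)) => x [[Px Qx] [Rx Sx]].
exact: PQRS.
Qed.

(* Evaluation at T = N of rational functions of T, and of elements of an algebraic
   extension of C(T), is not a ring morphism because of poles; but each single
   identity is preserved when N is large enough. *)
Definition eventual_morphism (A B : nzRingType) (h : nat -> A -> B) : Prop :=
  [/\ forall a b, \forall N \near \oo, h N (a + b) = h N a + h N b,
      forall a b, \forall N \near \oo, h N (a * b) = h N a * h N b &
      \forall N \near \oo, h N 1 = 1].

Section EventualMorphism.
Variables (A B : nzRingType) (h : nat -> A -> B).
Hypothesis hP : eventual_morphism h.

Let hD a b : \forall N \near \oo, h N (a + b) = h N a + h N b.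
Proof. by have [] := hP. Qed.
Let hM a b : \forall N \near \oo, h N (a * b) = h N a * h N b.
Proof. by have [] := hP. Qed.

Lemma eventual0 : \forall N \near \oo, h N 0 = 0.
Proof.
have := hD 0 0; apply: filterS => N; rewrite addr0 => /eqP.
by rewrite -subr_eq0 opprD addNKr oppr_eq0 => /eqP.
Qed.

Lemma eventualB a b : \forall N \near \oo, h N (a - b) = h N a - h N b.
Proof.
have := hD (a - b) b; apply: filterS => N.
by rewrite subrK => ->; rewrite addrK.
Qed.

Lemma eventual_sum (I : Type) (r : seq I) (P : pred I) (F : I -> A) :
  \forall N \near \oo, h N (\sum_(i <- r | P i) F i) = \sum_(i <- r | P i) h N (F i).
Proof.
elim: r => [|i r IHr].
  by apply: filterS eventual0 => N h0; rewrite !big_nil.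
have := hD (F i) (\sum_(j <- r | P j) F j).
move: IHr; apply: filterS2 => N; rewrite !big_cons.
by case: ifP => // _ <- ->.
Qed.

End EventualMorphism.

Lemma eventual_neq0 (A : fieldType) (B : nzRingType) (h : nat -> A -> B) a :
  eventual_morphism h -> a != 0 -> \forall N \near \oo, h N a != 0.
Proof.
move=> [_ hM h1] a_neq0; have := hM a a^-1; move: h1; apply: filterS2 => N h1.
rewrite divff // h1 => /eqP; apply: contraTneq => ->.
by rewrite mul0r oner_eq0.
Qed.

Section EventualHorner.
Variables (A B : comNzRingType) (h : nat -> A -> B) (t : nat -> B).
Hypothesis hP : eventual_morphism h.

Let hv N (p : {poly A}) : B := (map_poly (h N) p).[t N].

(** Neither sizes nor zero coefficients are preserved by [h N] for every N. Summing over a fixed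
    range of indices reduces each identity to finitely many coefficient identities. *)
Let hv_widen n (p : {poly A}) : (size p <= n)%N ->
  \forall N \near \oo, hv N p = \sum_(i < n) h N p`_i * t N ^+ i.
Proof.
move=> le_n; apply: filterS (eventual0 hP) => N h0.
rewrite /hv horner_poly (big_ord_widen n (fun i => h N p`_i * t N ^+ i)) //.
rewrite big_mkcond; apply: eq_bigr => i _; case: ltnP => // le_i.
by rewrite nth_default // h0 mul0r.
Qed.

Let hvC a : \forall N \near \oo, hv N a%:P = h N a.
Proof.
have := @hv_widen 1 a%:P (size_polyC_leq1 a); apply: filterS => N ->.
by rewrite big_ord1 coefC mulr1.
Qed.

Let hvD p q : \forall N \near \oo, hv N (p + q) = hv N p + hv N q.
Proof.
pose n := maxn (size p) (size q).
have hD : \forall N \near \oo, forall i : 'I_n, h N (p`_i + q`_i) = h N p`_i + h N q`_i.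
  by apply: filter_forall => i; have [hD _ _] := hP.
have := hv_widen (leq_maxl (size p) (size q)).
have := hv_widen (leq_maxr (size p) (size q)).
have := hv_widen (size_polyD p q).
move: hD; apply: filterS4 => N hD -> -> ->; rewrite -big_split.
by apply: eq_bigr => i _; rewrite /= coefD hD mulrDl.
Qed.

Let hvMX p : \forall N \near \oo, hv N (p * 'X) = hv N p * t N.
Proof.
have le_n : (size (p * 'X)%R <= (size p).+1)%N.
  by rewrite (leq_trans (size_polyMleq _ _)) // size_polyX addn2.
have := hv_widen (leqnn (size p)); have := hv_widen le_n; have := eventual0 hP.
apply: filterS3 => N h0 -> ->; rewrite big_ord_recl coefMX eqxx h0 mul0r add0r.
by rewrite mulr_suml; apply: eq_bigr => i _; rewrite coefMX exprSr mulrA.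
Qed.

Let hvCM a p : \forall N \near \oo, hv N (a%:P * p) = h N a * hv N p.
Proof.
have le_n : (size (a%:P * p)%R <= size p)%N by rewrite mul_polyC size_scale_leq.
have hM : \forall N \near \oo, forall i : 'I_(size p), h N (a * p`_i) = h N a * h N p`_i.
  by apply: filter_forall => i; have [_ hM _] := hP.
have := hv_widen (leqnn (size p)); have := hv_widen le_n; move: hM.
apply: filterS3 => N hM -> ->; rewrite mulr_sumr.
by apply: eq_bigr => i _; rewrite coefCM hM mulrA.
Qed.

Lemma eventual_horner_eval : eventual_morphism hv.
Proof.
split=> // [p q|]; last first.
  by have [_ _] := hP; move: (hvC 1); apply: filterS2 => N ->.
elim/poly_ind: p => [|p a IHp].
  have := hvC 0; have := eventual0 hP; apply: filterS2 => N h0 hv0.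
  by rewrite mul0r hv0 h0 mul0r.
have Dpq : (p * 'X + a%:P) * q = (p * q) * 'X + a%:P * q by ring.
have h1 := hvD (p * 'X) a%:P; have h2 := hvC a; have h3 := hvMX p.
have h4 := hvMX (p * q); have h5 := hvCM a q.
have h6 := hvD ((p * q) * 'X) (a%:P * q); near=> N; rewrite Dpq.
have -> : hv N (p * q * 'X + a%:P * q) = hv N (p * q * 'X) + hv N (a%:P * q) by near: N.
have -> : hv N (p * q * 'X) = hv N (p * q) * t N by near: N.
have -> : hv N (p * q) = hv N p * hv N q by near: N.
have -> : hv N (a%:P * q) = h N a * hv N q by near: N.
have -> : hv N (p * 'X + a%:P) = hv N (p * 'X) + hv N a%:P by near: N.
have -> : hv N (p * 'X) = hv N p * t N by near: N.
have -> : hv N a%:P = h N a by near: N.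
by ring.
Unshelve. all: by end_near.
Qed.

Lemma eventual_horner_evalC a : \forall N \near \oo, hv N a%:P = h N a.
Proof. exact: hvC. Qed.

End EventualHorner.

(** Write [E = F(z)] with z a primitive element of minimal polynomial m, and send z to a root [t N]
    of the specialized m. Each u is specialized through a chosen polynomial expression in z; two
    expressions differ by a multiple of m, which is eventually sent to 0. *)
Lemma eventual_extension (F : fieldType) (C : closedFieldType) (h : nat -> F -> C)
    (E : fieldExtType F) : [pchar F] =i pred0 -> eventual_morphism h ->
  exists2 hE : nat -> E -> C, eventual_morphism hE &
    forall a, \forall N \near \oo, hE N a%:A = h N a.
Proof.
move=> pchar0 hP.
have sepE : separable 1 {:E}.
  apply/separableP => u _; apply: pcharf0_separable => p.
  by rewrite pchar_lalg pchar0.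
pose z := separable_generator 1 {:E}.
have genE u : u \in <<1; z>>%VS.
  by apply: (subvP (sub_adjoin_separable_generator sepE)); rewrite memvf.
have /choice[rep repP] u : exists p : {poly F}, (map_poly (in_alg E) p).[z] = u.
  have /polyOver1P[p Dp] := Fadjoin_polyOver 1 z u.
  by exists p; rewrite -Dp Fadjoin_poly_eq.
have /polyOver1P[m Dm] := minPolyOver 1 z.
have m_monic : m \is monic by rewrite -(map_monic (in_alg E)) -Dm monic_minPoly.
have size_m : (1 < size m)%N.
  rewrite -(size_map_poly (in_alg E)) -Dm (root_size_gt1 _ (root_minPoly 1 z)) //.
  by rewrite monic_neq0 ?monic_minPoly.
(* The value 0 is a placeholder for those N where the specialization of m has no root; for large N
   the leading coefficient stays 1, so a root exists. *)
have /choice[t tP] N :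
    exists t, size (map_poly (h N) m) != 1%N -> root (map_poly (h N) m) t.
  have [_|/closed_rootP[t mt]] := eqVneq (size (map_poly (h N) m)) 1%N.
    by exists 0.
  by exists t.
have hvP := eventual_horner_eval t hP.
pose hv N p := (map_poly (h N) p).[t N].
have hvm : \forall N \near \oo, hv N m = 0.
  have [_ _] := hP; apply: filterS => N h1; apply/rootP/tP.
  rewrite size_map_poly_id0; first by rewrite gtn_eqF.
  by rewrite (monicP m_monic) h1 oner_eq0.
have hv_eq p q : (map_poly (in_alg E) p).[z] = (map_poly (in_alg E) q).[z] ->
    \forall N \near \oo, hv N p = hv N q.
  move=> /eqP; rewrite -subr_eq0 -hornerN -hornerD -rmorphB /= => pq_z.
  have /dvdpP[s Ds] : m %| p - q.
    by rewrite -(dvdp_map (in_alg E)) -Dm minPoly_dvdp //; apply/polyOver1P; eexists.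
  have [_ hvM _] := hvP; have := hvM s m; have := eventualB hvP p q; move: hvm.
  apply: filterS3 => N hvm; rewrite Ds => hB hM; apply/eqP.
  by rewrite -subr_eq0 -[_ - _]hB [X in X == 0]hM -/(hv N m) hvm mulr0.
exists (fun N u => hv N (rep u)).
  split=> [u v|u v|].
  - have := hv_eq (rep (u + v)) (rep u + rep v).
    rewrite rmorphD hornerD !repP => /(_ erefl).
    by have [hvD _ _] := hvP; move: (hvD (rep u) (rep v)); apply: filterS2 => N <-.
  - have := hv_eq (rep (u * v)) (rep u * rep v).
    rewrite rmorphM hornerM !repP => /(_ erefl).
    by have [_ hvM _] := hvP; move: (hvM (rep u) (rep v)); apply: filterS2 => N <-.
  have := hv_eq (rep 1) 1; rewrite rmorph1 hornerC repP => /(_ erefl).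
  by have [_ _] := hvP; apply: filterS2 => N <-.
move=> a; have := hv_eq (rep a%:A) a%:P; rewrite map_polyC hornerC repP => /(_ erefl).
by have := eventual_horner_evalC t hP a; apply: filterS2 => N <-.
Qed.

Section Specialization.
Variable C : numClosedFieldType.

Lemma near_horner_neq0 (p : {poly C}) :
  p != 0 -> \forall N \near \oo, p.[N%:R] != 0.
Proof.
move=> p_neq0; have [r Dp] := closed_field_poly_normal p.
have : \forall N \near \oo, all (fun z => N%:R != z) r.
  elim: (r) => [|z s IHs] /=; first exact: nearW.
  have : \forall N \near \oo, N%:R != z.
    have [[M <-]|noM] := pselect (exists M, M%:R = z).
      by exists M.+1 => // N /= ltMN; rewrite eqr_nat gtn_eqF.
    by apply: nearW => N; apply/eqP => DN; apply: noM; exists N.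
  by apply: filterS2 IHs => N -> ->.
apply: filterS => N /allP rN; rewrite Dp hornerZ mulf_neq0 ?lead_coef_eq0 //.
rewrite horner_prod prodf_seq_neq0 /=.
by apply/allP => z rz; rewrite !hornerE subr_eq0 rN.
Qed.

Lemma eventual_fraction : exists2 ev : nat -> ratfrac C -> C,
  eventual_morphism ev &
  forall p : {poly C}, \forall N \near \oo, ev N (tofrac p) = p.[N%:R].
Proof.
have /choice[g gP] (a : ratfrac C) : exists pq : {poly C} * {poly C},
    pq.2 != 0 /\ tofrac pq.2 * a = tofrac pq.1.
  by have [p [q Da]] := tofrac_quotient a; exists (p, q).
pose ev N a := (g a).1.[N%:R] / (g a).2.[N%:R].
(* The chosen quotient [g a] eventually gives the same value as any other one, by
   cross-multiplication; this yields additivity and multiplicativity. *)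
have evP (a : ratfrac C) (p q : {poly C}) : q != 0 -> tofrac q * a = tofrac p ->
    \forall N \near \oo, q.[N%:R] * ev N a = p.[N%:R].
  move=> q_neq0 Da; have [q1_neq0 Da1] := gP a.
  have Dpq : (g a).2 * p = q * (g a).1.
    by apply/eqP; rewrite -tofrac_eq !rmorphM /= -Da -Da1; apply/eqP; ring.
  apply: filterS (near_horner_neq0 q1_neq0) => N q1N0.
  by apply: (mulfI q1N0); rewrite -[RHS]hornerM Dpq hornerM /ev; field.
have evp (p : {poly C}) : \forall N \near \oo, ev N (tofrac p) = p.[N%:R].
  have := evP (tofrac p) p 1 (oner_neq0 _).
  by rewrite rmorph1 mul1r => /(_ erefl); apply: filterS => N; rewrite hornerC mul1r.
exists ev => //; split=> [a b|a b|].
- have [p [q [q_neq0 Da]]] := tofrac_quotient a; have [r [s [s_neq0 Db]]] := tofrac_quotient b.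
  have qs_neq0 : q * s != 0 by rewrite mulf_neq0.
  have Dab : tofrac (q * s) * (a + b) = tofrac (p * s + r * q).
    by rewrite rmorphD !rmorphM /= -Da -Db; ring.
  have := evP _ _ _ q_neq0 Da; have := evP _ _ _ s_neq0 Db.
  have := evP _ _ _ qs_neq0 Dab; have := near_horner_neq0 qs_neq0.
  apply: filterS4 => N; rewrite !(hornerD, hornerM) => qsN Eab Eb Ea.
  by apply: (mulfI qsN); rewrite Eab mulrDr -Ea -Eb; ring.
- have [p [q [q_neq0 Da]]] := tofrac_quotient a; have [r [s [s_neq0 Db]]] := tofrac_quotient b.
  have qs_neq0 : q * s != 0 by rewrite mulf_neq0.
  have Dab : tofrac (q * s) * (a * b) = tofrac (p * r).
    by rewrite !rmorphM /= -Da -Db; ring.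
  have := evP _ _ _ q_neq0 Da; have := evP _ _ _ s_neq0 Db.
  have := evP _ _ _ qs_neq0 Dab; have := near_horner_neq0 qs_neq0.
  apply: filterS4 => N; rewrite !(hornerD, hornerM) => qsN Eab Eb Ea.
  by apply: (mulfI qsN); rewrite Eab -Ea -Eb; ring.
by have := evp 1; apply: filterS => N; rewrite rmorph1 hornerC.
Qed.

Lemma pchar_ratfrac : [pchar ratfrac C] =i pred0.
Proof.
apply/pcharf0P => n; rewrite -(rmorph_nat (@FracField.tofrac {poly C})) tofrac_eq0.
by rewrite -(rmorph_nat (@polyC C)) polyC_eq0 pnatr_eq0.
Qed.

Lemma eventual_specialization (E : fieldExtType (ratfrac C)) :
  exists2 h : nat -> E -> C, eventual_morphism h &
    forall (w : {poly {poly C}}) (x : E), \forall N \near \oo,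
      h N (map_poly (of_poly E) w).[x] = (map_poly (horner_eval N%:R) w).[h N x].
Proof.
have [ev evP evp] := eventual_fraction.
have [h hP hev] := eventual_extension E pchar_ratfrac evP; exists h => // w x.
have hp (p : {poly C}) : \forall N \near \oo, h N (of_poly E p) = p.[N%:R].
  by have := evp p; have := hev (tofrac p); apply: filterS2 => N <- <-.
have [hD hM _] := hP.
elim/poly_ind: w => [|w c IHw].
  by have := eventual0 hP; apply: filterS => N h0; rewrite !rmorph0 !horner0.
have := hp c; have := hM (map_poly (of_poly E) w).[x] x.
have := hD ((map_poly (of_poly E) w).[x] * x) (of_poly E c).
move: IHw; apply: filterS4 => N IHw.
rewrite !rmorphD !rmorphM /= !map_polyX !map_polyC !hornerE /= => -> ->.
by rewrite IHw => ->.
Qed.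

End Specialization.

(** * Partial fractions *)

(* Division of the Laurent polynomial u / x^a by f; x is invertible modulo f
   because f(0) is a unit. *)
Lemma reduce_modulo (R : idomainType) (f u : {poly R}) (a : nat) :
    lead_coef f \is a GRing.unit -> f`_0 \is a GRing.unit ->
  exists w v : {poly R}, (size w < size f)%N /\ u = 'X^a * w + f * v.
Proof.
move=> lead_unit f0_unit; pose b := (f`_0)^-1.
have [g Dg] : exists g, b *: f = 1 - 'X * g.
  have [p [c Df]] : exists p c, f = p * 'X + c%:P.
    by elim/poly_ind: (f) => [|p c _]; [exists 0, 0; rewrite mul0r addr0 | exists p, c].
  have Dc : f`_0 = c by rewrite Df coefD coefMX coefC add0r.
  exists (- (b *: p)); rewrite Df scalerDr -[b *: c%:P]mul_polyC -polyCM /b Dc mulVr.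
    by rewrite mulrN opprK addrC scalerAl mulrC.
  by rewrite -Dc.
(* By telescoping, [(1 - X g) s = 1 - (X g)^a], so [g^a] is an inverse of [X^a] modulo f. *)
pose s := \sum_(i < a) ('X * g) ^+ i.
have Ds : 1 = 'X^a * g ^+ a + f * (b *: s).
  rewrite -scalerAr scalerAl Dg /s -exprMn.
  by rewrite -opprB mulNr -subrX1; ring.
exists ((g ^+ a * u) %% f), (b *: s * u + 'X^a * ((g ^+ a * u) %/ f)).
split.
  by rewrite ltn_modp -lead_coef_eq0 (contraTneq _ lead_unit) // => ->; rewrite unitr0.
have Dd := Pdiv.IdomainUnit.divp_eq lead_unit (g ^+ a * u).
rewrite -[LHS]mul1r Ds.
transitivity ('X^a * (g ^+ a * u) + f * (b *: s * u)); first by ring.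
by rewrite {1}Dd; ring.
Qed.

Lemma poly_eq0_roots (F : fieldType) n (x : 'I_n -> F) (p : {poly F}) :
  injective x -> (size p <= n)%N -> (forall i, p.[x i] = 0) -> p = 0.
Proof.
move=> x_inj le_n px; apply: (roots_geq_poly_eq0 (rs := codom x)).
- by apply/allP => _ /codomP[i ->]; apply/rootP.
- by apply/injectiveP.
- by rewrite size_codom card_ord.
Qed.

Section Lagrange.
Variables (F : fieldType) (n : nat) (x : 'I_n -> F) (f w : {poly F}).
Hypotheses (x_inj : injective x) (fx : forall i, f.[x i] = 0).
Hypotheses (size_f : size f = n.+1) (size_w : (size w <= n)%N).

Let f_ i := f %/ ('X - (x i)%:P).

Let fE i : f = f_ i * ('X - (x i)%:P).
Proof. by apply/esym/divpK; rewrite dvdp_XsubCl; apply/rootP. Qed.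

Let size_f_ i : size (f_ i) = n.
Proof. by rewrite size_divp ?polyXsubC_eq0 // size_XsubC size_f subn1. Qed.

Let f_x i j : (f_ i).[x j] = f^`().[x i] *+ (i == j).
Proof.
case: eqVneq => [<-|ij].
  have -> : f^`() = (f_ i)^`() * ('X - (x i)%:P) + f_ i.
    by rewrite {1}(fE i) derivM derivXsubC mulr1.
  by rewrite hornerD hornerM hornerXsubC subrr mulr0 add0r.
have /eqP := fx j; rewrite {1}(fE i) hornerM hornerXsubC mulf_eq0 subr_eq0.
by rewrite (inj_eq x_inj) [j == i]eq_sym (negPf ij) orbF => /eqP.
Qed.

Lemma deriv_root_neq0 i : f^`().[x i] != 0.
Proof.
apply/eqP => dfx; have : f_ i = 0.
  apply: (poly_eq0_roots x_inj); first by rewrite size_f_.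
  by move=> j; rewrite f_x dfx mul0rn.
move=> fi0; have := leq_ltn_trans (leq0n i) (ltn_ord i).
by rewrite -[X in (_ < X)%N](size_f_ i) fi0 size_poly0.
Qed.

(** Both sides have size at most n and agree at the n distinct points [x i]. *)
Lemma lagrange_interpolation : w = \sum_i (w.[x i] / f^`().[x i]) *: f_ i.
Proof.
apply/eqP; rewrite -subr_eq0; apply/eqP/(poly_eq0_roots x_inj).
  rewrite (leq_trans (size_polyD _ _)) // geq_max size_w size_polyN /=.
  apply: leq_trans (size_sum _ _ _) _; apply/bigmax_leqP => i _.
  by rewrite (leq_trans (size_scale_leq _ _)) // size_f_.
move=> j; rewrite hornerD hornerN horner_sum (bigD1 j) //= big1 => [|i ij].
  by rewrite addr0 hornerZ f_x eqxx mulfVK ?subrr ?deriv_root_neq0.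
by rewrite hornerZ f_x (negPf ij) mulr0.
Qed.

Lemma partial_fractions z : f.[z] != 0 ->
  w.[z] / f.[z] = \sum_i w.[x i] / f^`().[x i] * (z - x i)^-1.
Proof.
move=> fz; rewrite {1}lagrange_interpolation horner_sum mulr_suml.
apply: eq_bigr => i _; rewrite hornerZ -mulrA; congr (_ * _).
have fzE : f.[z] = (f_ i).[z] * (z - x i) by rewrite {1}(fE i) hornerM hornerXsubC.
move: fz; rewrite fzE mulf_eq0 => /norP[fi0 zx0].
by rewrite invfM mulrA divff // mul1r.
Qed.

(** Compare coefficients of degree [n - 1] in the interpolation formula; every [f_ i] has the
    leading coefficient of f. *)
Lemma sum_residues : \sum_i w.[x i] / f^`().[x i] = w`_n.-1 / lead_coef f.
Proof.
have f_neq0 : f != 0 by rewrite -size_poly_eq0 size_f.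
rewrite [in RHS]lagrange_interpolation coef_sum mulr_suml.
apply: eq_bigr => i _; rewrite coefZ -mulrA.
have <- : lead_coef (f_ i) = lead_coef f.
  by rewrite [in RHS](fE i) lead_coefM lead_coefXsubC mulr1.
have <- : lead_coef (f_ i) = (f_ i)`_n.-1 by rewrite lead_coefE size_f_.
rewrite divff ?mulr1 // lead_coef_eq0.
by apply: contraNneq f_neq0 => fi0; rewrite (fE i) fi0 mul0r.
Qed.
End Lagrange.

(** * Averages over roots of unity *)

Lemma prim_root_exists (C : numClosedFieldType) n : (0 < n)%N ->
  exists z : C, n.-primitive_root z.
Proof.
move=> n_gt0; have [r] := closed_field_poly_normal ('X^n - 1 : {poly C}).
rewrite lead_coefXnsubC // scale1r => Dr.
suffices /hasP[z _ prim_z] : has n.-primitive_root r by exists z.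
apply: has_prim_root => //.
- by apply/allP => z; rewrite -root_prod_XsubC -Dr.
- rewrite -separable_prod_XsubC -Dr separable_Xn_sub_1 //.
  by rewrite pnatr_eq0 -lt0n.
- by rewrite -ltnS -(size_prod_XsubC r id) -Dr size_XnsubC.
Qed.

Section RootMean.
Variables (C : numClosedFieldType) (M : nat) (w : C).
Hypotheses (prim_w : M.-primitive_root w).
Implicit Types (g h : C -> C) (z : C) (p : {poly C}).

(* Discrete version of the integral of g(z) dz / (2 pi i) over the unit circle. *)
Definition root_mean g : C :=
  M%:R^-1 * \sum_(j < M) g (w ^+ j) * w ^+ j.

Let M_gt0 : (0 < M)%N. Proof. exact: prim_order_gt0 prim_w. Qed.
Let M_neq0 : M%:R != 0 :> C. Proof. by rewrite pnatr_eq0 -lt0n. Qed.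

Let norm_root j : `|w ^+ j| = 1.
Proof.
apply/eqP; rewrite -(pexpr_eq1 M_gt0) //.
by rewrite -normrX -exprM mulnC exprM (prim_expr_order prim_w) expr1n normr1 eqxx.
Qed.

Lemma eq_root_mean g h : (forall z, `|z| = 1 -> g z = h z) ->
  root_mean g = root_mean h.
Proof. by move=> gh; congr (_ * _); apply: eq_bigr => j _; rewrite gh. Qed.

Lemma root_meanD g h : root_mean (fun z => g z + h z) = root_mean g + root_mean h.
Proof.
rewrite /root_mean -mulrDr -big_split; congr (_ * _).
by apply: eq_bigr => j _; rewrite mulrDl.
Qed.

Lemma root_mean_sum n (a : 'I_n -> C) (g : 'I_n -> C -> C) :
  root_mean (fun z => \sum_i a i * g i z) = \sum_i a i * root_mean (g i).
Proof.
rewrite /root_mean; under eq_bigr do rewrite mulr_suml.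
rewrite exchange_big mulr_sumr; apply: eq_bigr => i _ /=.
rewrite mulrCA; congr (_ * _); rewrite mulr_sumr.
by apply: eq_bigr => j _; rewrite mulrA.
Qed.

Lemma root_mean_le g (B : C) : (forall z, `|z| = 1 -> `|g z| <= B) ->
  `|root_mean g| <= B.
Proof.
move=> gB; rewrite normrM normfV normr_nat mulrC ler_pdivrMr ?ltr0n //.
apply: le_trans (ler_norm_sum _ _ _) _.
rewrite -[leRHS](_ : \sum_(j < M) B = _); last by rewrite sumr_const card_ord mulr_natr.
by apply: ler_sum => j _; rewrite normrM norm_root mulr1 gB.
Qed.

Let sum_root_powers s t : (s < M)%N -> (t < M)%N ->
  \sum_(j < M) (w ^+ j) ^+ s / (w ^+ j) ^+ t = M%:R *+ (s == t).
Proof.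
move=> ltsM lttM; pose r := w ^+ s / w ^+ t.
have wt0 : w ^+ t != 0 by rewrite -normr_eq0 norm_root oner_eq0.
have -> : \sum_(j < M) (w ^+ j) ^+ s / (w ^+ j) ^+ t = \sum_(j < M) r ^+ j.
  apply: eq_bigr => j _.
  by rewrite /r exprMn exprVn -!exprM ![(_ * j)%N]mulnC.
have := subrX1 r M.
have -> : r ^+ M = 1.
  rewrite /r exprMn exprVn -!exprM ![(_ * M)%N]mulnC !exprM.
  by rewrite (prim_expr_order prim_w) !expr1n invr1 mulr1.
rewrite subrr; case: eqVneq => [st _|st].
  rewrite /r st divff // (eq_bigr (fun=> 1)) => [|j _]; last exact: expr1n.
  by rewrite sumr_const card_ord.
move/esym/eqP; rewrite mulf_eq0 subr_eq0 => /orP[|/eqP //].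
rewrite -(inj_eq (mulIf wt0)) mulfVK // mul1r (eq_prim_root_expr prim_w).
by rewrite !modn_small // (negPf st).
Qed.

(** Powers of z are orthogonal over the M-th roots of unity. Both size conditions exclude aliasing:
    exponents below M are congruent modulo M only if equal. *)
Lemma root_mean_laurent p a : (size p <= M)%N -> (a < M)%N ->
  root_mean (fun z => p.[z] / z ^+ a.+1) = p`_a.
Proof.
move=> le_pM lt_aM.
have eq_term j : p.[w ^+ j] / (w ^+ j) ^+ a.+1 * w ^+ j =
    \sum_(s < M) p`_s * ((w ^+ j) ^+ s / (w ^+ j) ^+ a).
  have wj0 : w ^+ j != 0 by rewrite -normr_eq0 norm_root oner_eq0.
  rewrite (horner_coef_wide _ le_pM) -mulrA exprS invfM mulrAC mulVf // mul1r.
  by rewrite mulr_suml; apply: eq_bigr => s _; rewrite mulrA.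
rewrite /root_mean; under eq_bigr do rewrite eq_term.
rewrite exchange_big /= (bigD1 (Ordinal lt_aM)) //= [X in _ + X]big1 => [|s sa].
  by rewrite -mulr_sumr sum_root_powers // eqxx mulr1n addr0 mulrCA mulVf ?mulr1.
by rewrite -mulr_sumr sum_root_powers // (negPf (sa : s != a :> nat)) mulr0.
Qed.

(** On the M-th roots of unity, [z / (z - a)] is [(1 - a^M)^-1] times the sum of [(a / z)^i] for
    [i < M], and only [i = 0] survives the averaging. For large M this tends to the residue count: 1
    inside the disc, 0 outside. *)
Lemma root_mean_pole a : `|a| != 1 ->
  root_mean (fun z => (z - a)^-1) = (1 - a ^+ M)^-1.
Proof.
move=> na1; have aM1 : 1 - a ^+ M != 0.
  apply: contraNneq na1 => /eqP; rewrite subr_eq0 eq_sym => /eqP aM1.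
  by rewrite -(pexpr_eq1 M_gt0) // -normrX aM1 normr1 eqxx.
have eq_term (j : 'I_M) : (w ^+ j - a)^-1 * w ^+ j =
    (1 - a ^+ M)^-1 * \sum_(i < M) a ^+ i * ((w ^+ j) ^+ 0 / (w ^+ j) ^+ i).
  have wj0 : w ^+ j != 0 by rewrite -normr_eq0 norm_root oner_eq0.
  have wja : w ^+ j - a != 0.
    by apply: contraNneq na1 => /eqP; rewrite subr_eq0 => /eqP <-; rewrite norm_root.
  apply: (mulfI aM1); rewrite mulVKf //.
  under eq_bigr do rewrite expr0 mul1r -exprVn -exprMn.
  have := subrX1 (a / w ^+ j) M.
  rewrite exprMn exprVn -exprM mulnC exprM (prim_expr_order prim_w) expr1n invr1 mulr1.
  move=> Da; apply: (mulfI (_ : a / w ^+ j - 1 != 0)).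
    by rewrite -(inj_eq (mulIf wj0)) mulrBl mulfVK // mul1r mul0r -oppr_eq0 opprB.
  by rewrite -Da; field; rewrite wja.
rewrite /root_mean; under eq_bigr do rewrite eq_term.
rewrite -mulr_sumr exchange_big /=.
rewrite [X in _ * (_ * X)](_ : _ = M%:R); first by rewrite mulrCA mulVf ?mulr1.
rewrite (bigD1 (Ordinal M_gt0)) //= [X in _ + X]big1 => [|i i0].
  by rewrite -mulr_sumr sum_root_powers // eqxx addr0 expr0 mul1r.
rewrite -mulr_sumr sum_root_powers // [0%N == _]eq_sym.
by rewrite (negPf (i0 : i != 0%N :> nat)) mulr0.
Qed.

End RootMean.

(** * Limits of averages over roots of unity *)

Definition climit (C : numDomainType) (u : nat -> C) (l : C) : Prop :=
  forall e, 0 < e -> \forall M \near \oo, `|u M - l| < e.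

Section Climit.
Variable C : numFieldType.
Implicit Types (u v : nat -> C) (l a : C).

Lemma climit_eq u v l : (\forall M \near \oo, u M = v M) -> climit v l -> climit u l.
Proof. by move=> uv vl e /vl; move: uv; apply: filterS2 => M ->. Qed.

Lemma climit_cst l : climit (fun=> l) l.
Proof. by move=> e e0; apply: nearW => M; rewrite subrr normr0. Qed.

Lemma climit_unique u l l' : climit u l -> climit u l' -> l = l'.
Proof.
move=> ul ul'; apply/eqP; rewrite -subr_eq0 -normr_eq0; apply/negPn/negP => ll'.
have e0 : 0 < `|l - l'| / 2 by rewrite divr_gt0 // lt_def ll' normr_ge0.
have [M [ulM ulM']] := filter_ex (filterI (ul _ e0) (ul' _ e0)).
have : `|l - l'| < `|l - l'|; last by rewrite ltxx.
rewrite {1}(_ : l - l' = (u M - l') - (u M - l)); last by ring.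
apply: le_lt_trans (ler_normB _ _) _; rewrite [ltRHS](splitr).
exact: ltrD.
Qed.

Lemma climitD u v l l' : climit u l -> climit v l' ->
  climit (fun M => u M + v M) (l + l').
Proof.
move=> ul vl' e e0; have e20 : 0 < e / 2 by rewrite divr_gt0.
move: (ul _ e20) (vl' _ e20); apply: filterS2 => M ulM vlM.
rewrite opprD addrACA (splitr e); apply: le_lt_trans (ler_normD _ _) _.
exact: ltrD.
Qed.

Lemma climitZ a u l : climit u l -> climit (fun M => a * u M) (a * l).
Proof.
move=> ul e e0; have [->|a0] := eqVneq a 0.
  by apply: nearW => M; rewrite !mul0r subrr normr0.
have na0 : 0 < `|a| by rewrite normr_gt0.
have := ul (e / `|a|); rewrite divr_gt0 // => /(_ isT); apply: filterS => M.
by rewrite -mulrBr normrM ltr_pdivlMr // mulrC.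
Qed.

Lemma climit_sum n (a : 'I_n -> C) (u : 'I_n -> nat -> C) (l : 'I_n -> C) :
  (forall i, climit (u i) (l i)) ->
  climit (fun M => \sum_i a i * u i M) (\sum_i a i * l i).
Proof.
elim: n a u l => [|n IHn] a u l ul.
  by under [X in climit X]eq_fun do rewrite big_ord0; rewrite big_ord0; apply: climit_cst.
under [X in climit X]eq_fun do rewrite big_ord_recl; rewrite big_ord_recl.
by apply: climitD (climitZ _ (ul _)) (IHn _ _ _ (fun i => ul _)).
Qed.

End Climit.

Section Poles.
Variable C : numClosedFieldType.
(** An abstract [numClosedFieldType] need not be archimedean; [complex_geometric] supplies this for
    [R[i]]. *)
Hypothesis geometric : forall x : C, 0 <= x < 1 -> forall e, 0 < e ->
  \forall M \near \oo, x ^+ M < e.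

Lemma climit_pole (a : C) : `|a| != 1 ->
  climit (fun M => (1 - a ^+ M)^-1) (`|a| < 1)%R%:R.
Proof.
have small (b : C) : `|b| < 1 -> climit (fun M => (1 - b ^+ M)^-1) 1.
  move=> b1 e e0; have b01 : 0 <= `|b| < 1 by rewrite normr_ge0.
  have e20 : 0 < e / 2 by rewrite divr_gt0.
  have h0 : 0 < 2^-1 :> C by rewrite invr_gt0.
  move: (geometric b01 e20) (geometric b01 h0); apply: filterS2 => M be bh.
  (* Bounding the denominator below by one half makes the error [b^M / (1 - b^M)] at most twice the
     norm of [b^M]. *)
  have half_le : 2^-1 <= `|1 - b ^+ M|.
    apply: le_trans (lerB_dist _ _); rewrite normr1 normrX.
    by rewrite lerBrDr [leRHS](_ : 1 = 2^-1 + 2^-1) ?lerD2l ?ltW //; field.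
  have bM0 : 1 - b ^+ M != 0 by rewrite -normr_gt0 (lt_le_trans h0).
  rewrite (_ : _ - 1 = b ^+ M / (1 - b ^+ M)); last by field.
  rewrite normrM normfV ltr_pdivrMr ?normr_gt0 // normrX.
  by rewrite (lt_le_trans be) // ler_pM2l.
move=> a1; have [lt_a1|] := boolP (`|a| < 1); first exact: small.
rewrite -real_leNgt ?realE ?normr_ge0 ?ler01 // le_eqVlt eq_sym (negPf a1) /= => gt_a1.
have a0 : a != 0 by rewrite -normr_gt0 (lt_trans _ gt_a1).
(* Outside the disc, use [(1 - a^M)^-1 = 1 - (1 - a^-M)^-1] and the first case for [a^-1]. *)
have := climitD (climit_cst 1) (climitZ (-1) (small a^-1 _)).
rewrite normfV invf_lt1 ?normr_gt0 // mulr1 subrr => /(_ gt_a1).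
apply: climit_eq; exists 1%N => // M /= M0.
have aM1 : 1 - a ^+ M != 0.
  apply: contraNneq a1 => /eqP; rewrite subr_eq0 eq_sym => /eqP aM1.
  by rewrite -(pexpr_eq1 M0) // -normrX aM1 normr1.
have aM0 : a ^+ M != 0 by rewrite expf_neq0.
rewrite exprVn; have -> : 1 - (a ^+ M)^-1 = - (1 - a ^+ M) / a ^+ M by field.
by field; rewrite aM0 aM1.
Qed.

Variable w : nat -> C.
Hypothesis prim_w : forall M, (0 < M)%N -> M.-primitive_root (w M).

(** Partial fractions reduce [p / f] to simple poles, each contributing its residue exactly when it
    lies in the disc; the mean of the Laurent part equals [v_a] as soon as M is large. *)
Lemma climit_mean_rational n (x : 'I_n -> C) (f p v : {poly C}) (a : nat) (g : C -> C) :
    injective x -> (forall i, f.[x i] = 0) -> (forall i, `|x i| != 1) ->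
    size f = n.+1 -> (size p <= n)%N ->
    (forall z, `|z| = 1 -> f.[z] != 0) ->
    (forall z, `|z| = 1 -> g z = p.[z] / f.[z] + v.[z] / z ^+ a.+1) ->
  climit (fun M => root_mean M (w M) g)
    (\sum_(i in [set i | `|x i| < 1]%SET) p.[x i] / f^`().[x i] + v`_a).
Proof.
move=> x_inj fx x1 size_f size_p f1 Dg.
have -> : \sum_(i in [set i | `|x i| < 1]%SET) p.[x i] / f^`().[x i] =
    \sum_i p.[x i] / f^`().[x i] * (`|x i| < 1)%R%:R.
  rewrite big_mkcond; apply: eq_bigr => i _; rewrite inE.
  by case: ifP; rewrite ?mulr1 ?mulr0.
apply: climit_eq (climitD (climit_sum _ (fun i => climit_pole (x1 i))) (climit_cst _)).
exists (maxn (size v) a.+1) => // M /=; rewrite geq_max => /andP[le_vM lt_aM].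
have M0 : (0 < M)%N by apply: leq_ltn_trans lt_aM.
rewrite (@eq_root_mean _ _ _ (prim_w M0) _ (fun z => (\sum_i p.[x i] / f^`().[x i] *
    (z - x i)^-1) + v.[z] / z ^+ a.+1)) => [|z z1].
  rewrite root_meanD root_mean_sum root_mean_laurent ?prim_w //.
  by congr (_ + _); apply: eq_bigr => i _; rewrite root_mean_pole ?prim_w.
by rewrite Dg // (partial_fractions x_inj fx size_f size_p) // f1.
Qed.

(** Truncate the geometric expansion of [m / (T - L)] at order I. The terms before I have eventually
    exact means [c i], and the remainder [(L / T)^I m / (T - L)] is small on the circle, uniformly
    in M. *)
Lemma climit_mean_resolvent (L m : C -> C) (c : nat -> C) (B B' T : C) (i0 : nat) :
    (forall z, `|z| = 1 -> `|L z| <= B) -> (forall z, `|z| = 1 -> `|m z| <= B') ->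
    0 <= B -> B < T ->
    (forall i, \forall M \near \oo, root_mean M (w M) (fun z => L z ^+ i * m z) = c i) ->
    (forall i, (i0 <= i)%N -> c i = 0) ->
  climit (fun M => root_mean M (w M) (fun z => m z / (T - L z)))
    (\sum_(i < i0) (T ^- i.+1) * c i).
Proof.
move=> LB mB B0 BT meanc c0 e e0.
have T0 : 0 < T by apply: le_lt_trans BT.
have B'0 : 0 <= B' by apply: le_trans (mB 1 (normr1 _)).
have BT1 : 0 <= B / T < 1 by rewrite divr_ge0 ?ltr_pdivrMr ?mul1r ?BT // ltW.
have TB0 : 0 < T - B by rewrite subr_gt0.
(* This threshold makes the remainder bound [(B / T)^I (B' + 1) / (T - B)] less than e; the added 1
   keeps the divisor positive when [B' = 0]. *)
have e1 : 0 < e * (T - B) / (B' + 1) by rewrite divr_gt0 ?mulr_gt0 // ltr_wpDl.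
have [I0 _ /(_ (maxn I0 i0) (leq_maxl _ _)) ltI] := geometric BT1 e1.
pose I := maxn I0 i0; rewrite -/I in ltI.
have -> : \sum_(i < i0) T ^- i.+1 * c i = \sum_(i < I) T ^- i.+1 * c i.
  rewrite (big_ord_widen I (fun i => T ^- i.+1 * c i)) ?leq_maxr // big_mkcond.
  by apply: eq_bigr => i _; case: ltnP => // /c0 ->; rewrite mulr0.
have meanI : \forall M \near \oo, forall i : 'I_I,
    root_mean M (w M) (fun z => L z ^+ i * m z) = c i.
  by apply: filter_forall => i; apply: meanc.
have M1 : \forall M \near \oo, (0 < M)%N by exists 1%N.
move: M1 meanI; apply: filterS2 => M M0 meanI.
have TL z : `|z| = 1 -> T - B <= `|T - L z|.
  move=> z1; apply: le_trans (lerB_dist _ _); rewrite (gtr0_norm T0) lerD2l lerN2.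
  exact: LB.
have TL0 z : `|z| = 1 -> T - L z != 0.
  by move=> z1; rewrite -normr_gt0 (lt_le_trans TB0) ?TL.
rewrite (@eq_root_mean _ _ _ (prim_w M0) _ (fun z =>
  (\sum_(i < I) T ^- i.+1 * (L z ^+ i * m z)) + (L z / T) ^+ I * m z / (T - L z)));
  last first.
  move=> z z1; have T1 : T != 0 by rewrite gt_eqF.
  have -> : \sum_(i < I) T ^- i.+1 * (L z ^+ i * m z) =
      m z / T * \sum_(i < I) (L z / T) ^+ i.
    rewrite mulr_sumr; apply: eq_bigr => i _.
    by rewrite exprMn exprVn exprS invfM; ring.
  have := subrX1 (L z / T) I; set S := \sum_(i < I) _ => DS.
  have LT : L z / T - 1 != 0.
    by rewrite -(inj_eq (mulIf T1)) mulrBl mulfVK // mul1r mul0r -oppr_eq0 opprB TL0.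
  have -> : (L z / T) ^+ I = (L z / T - 1) * S + 1 by rewrite -DS subrK.
  by field; rewrite T1 TL0.
rewrite root_meanD root_mean_sum.
under eq_bigr do rewrite meanI.
rewrite addrC addKr.
apply: le_lt_trans (_ : (B / T) ^+ I * B' / (T - B) < e).
  apply: (root_mean_le (prim_w M0)) => z z1.
  rewrite !normrM normfV normrX normrM normfV (gtr0_norm T0).
  rewrite ler_pM ?mulr_ge0 ?exprn_ge0 ?divr_ge0 ?invr_ge0 ?(ltW T0) //.
    rewrite ler_pM ?exprn_ge0 ?divr_ge0 ?(ltW T0) ?mB //.
    by rewrite lerXn2r ?nnegrE ?divr_ge0 ?(ltW T0) // ler_pM2r ?invr_gt0 // LB.
  by rewrite lef_pV2 ?posrE ?TL // normr_gt0 TL0.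
rewrite ltr_pdivrMr //; apply: le_lt_trans (_ : (B / T) ^+ I * (B' + 1) < _).
  by rewrite ler_wpM2l ?exprn_ge0 ?divr_ge0 ?(ltW T0) // lerDl.
by rewrite -ltr_pdivlMr // ltr_wpDl.
Qed.

End Poles.

(** * The vanishing residue *)

Lemma gal_horner (C : fieldType) (E : splittingFieldType (ratfrac C))
    (s : gal_of {:E}) (w : {poly {poly C}}) (x : E) :
  s (map_poly (of_poly E) w).[x] = (map_poly (of_poly E) w).[s x].
Proof.
rewrite -horner_map -map_poly_comp; congr _.[_]; apply: eq_map_poly => p /=.
exact: rmorph_alg.
Qed.

Lemma horner_norm_le (C : numDomainType) (p : {poly C}) (z : C) :
  `|z| = 1 -> `|p.[z]| <= \sum_(i < size p) `|p`_i|.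
Proof.
move=> z1; rewrite horner_coef; apply: le_trans (ler_norm_sum _ _ _) _.
by apply: ler_sum => i _; rewrite normrM normrX z1 expr1n mulr1.
Qed.

Section Core.
Variable C : numClosedFieldType.
Hypothesis geometric : forall x : C, 0 <= x < 1 -> forall e, 0 < e ->
  \forall M \near \oo, x ^+ M < e.
Hypothesis archimedean : forall B : C, 0 <= B -> \forall N \near \oo, B < N%:R.
Variables (q u : {poly C}) (k a i0 : nat).
Hypotheses (q0 : q`_0 != 0) (k_gt0 : (0 < k)%N) (k_lt : (k < (size q).-1)%N).
Let n := (size q).-1.
(* The coefficient of 1/z in L^i m, where L = q / z^k and m = u / z^(a+1). *)
Let c i := (q ^+ i * u)`_(k * i + a).
(** Starting at [i0.+1] ensures that the remaining moments [i < i0.+1] include the one of index 0,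
    even for [i0 = 0]. *)
Hypothesis c0 : forall i, (i0.+1 <= i)%N -> c i = 0.

Let f := level_poly q k.
Let fN (N : C) : {poly C} := map_poly (horner_eval N) f.
Let fNE N : fN N = q - N *: 'X^k.
Proof.
rewrite /fN /f /level_poly rmorphB rmorphM /= map_polyC map_polyXn /= horner_evalE hornerX.
rewrite mul_polyC -map_poly_comp map_poly_id // => z _ /=.
by rewrite horner_evalE hornerC.
Qed.

Let size_fN N : size (fN N) = n.+1.
Proof.
rewrite fNE size_polyDl; first by rewrite /n prednK //; case: (size q) k_lt.
rewrite size_polyN (leq_ltn_trans (size_scale_leq _ _)) // size_polyXn.
by move: k_lt; case: (size q).
Qed.

(* The residue theorem for m / (N - L) = - (w / f + v / z^(a+1)) on the unit circle;
   the right-hand side comes from the geometric expansion of 1 / (N - L). *)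
Lemma residue_sum_eq (w v : {poly {poly C}}) (N : C) (x : 'I_n -> C) :
    'X^k * u^:P = 'X^(a.+1) * w + f * v -> (size w <= n)%N ->
    injective x -> (forall i, (fN N).[x i] = 0) ->
    \sum_(i < size q) `|q`_i| < N ->
  \sum_(i in [set i | `|x i| < 1]%SET)
     (map_poly (horner_eval N) w).[x i] / (fN N)^`().[x i] + (v`_a).[N] =
  - \sum_(i < i0.+1) N ^- i.+1 * c i.
Proof.
move=> Du size_w x_inj fx BN; set wN := map_poly _ w; pose vN := map_poly (horner_eval N) v.
have /boolp.choice[w0 prim_w0] (M : nat) : exists z : C, (0 < M)%N -> M.-primitive_root z.
  by case: (posnP M) => [->|/(prim_root_exists C)[z]]; [exists 0 | exists z].
(* On the circle q is bounded by the sum of the norms of its coefficients, hence smaller than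
   [N z^k] in norm. *)
have f1 z : `|z| = 1 -> (fN N).[z] != 0.
  move=> z1; apply/eqP; rewrite fNE !hornerE => /eqP; rewrite subr_eq0 => /eqP qz.
  have B0 : 0 <= \sum_(i < size q) `|q`_i| by apply: sumr_ge0.
  have := horner_norm_le q z1; rewrite qz normrM normrX z1 expr1n mulr1.
  rewrite ger0_norm ?(ltW (le_lt_trans B0 BN)) // => NB.
  by have := lt_le_trans BN NB; rewrite ltxx.
have x1 i : `|x i| != 1.
  by apply/eqP => /f1; rewrite fx eqxx.
have size_wN : (size wN <= n)%N by apply: leq_trans (size_poly _ _) size_w.
pose g z := wN.[z] / (fN N).[z] + vN.[z] / z ^+ a.+1.
have lim1 := climit_mean_rational geometric prim_w0 x_inj fx x1 (size_fN N) size_wN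
  f1 (fun z _ => erefl (g z)).
(* Divide [Du] at [T = N] by [z^(a+1) f] and use [f = - z^k (N - L)]; this is where the sign comes
   from. *)
have Dg z : `|z| = 1 -> g z = - u.[z] / z ^+ a.+1 / (N - q.[z] / z ^+ k).
  move=> z1; have z0 : z != 0 by rewrite -normr_eq0 z1 oner_eq0.
  have := congr1 (fun p => (map_poly (horner_eval N) p).[z]) Du.
  rewrite rmorphD !rmorphM /= !map_polyXn !hornerE -/wN -/vN.
  rewrite -map_poly_comp map_poly_id => [|y _ /=]; last by rewrite horner_evalE hornerC.
  have := f1 z z1; rewrite /g -/(fN N) fNE !hornerE => fz Duz.
  have -> : u.[z] = (z ^+ a.+1 * wN.[z] + (q.[z] - N * z ^+ k) * vN.[z]) / z ^+ k.
    by rewrite -Duz mulrAC divff ?mul1r ?expf_neq0.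
  by field; rewrite !expf_neq0 // fz andbT -oppr_eq0 opprB fz.
have lim2 : climit (fun M => root_mean M (w0 M) g) (\sum_(i < i0.+1) N ^- i.+1 * - c i).
  pose m := fun y : C => - u.[y] / y ^+ a.+1.
  pose L := fun y : C => q.[y] / y ^+ k.
  have z1X y j : `|y| = 1 -> `|y ^+ j| = 1 :> C by move=> y1; rewrite normrX y1 expr1n.
  have LB : forall z, `|z| = 1 -> `|L z| <= \sum_(i < size q) `|q`_i|.
    by move=> z z1; rewrite normrM normfV z1X // invr1 mulr1 horner_norm_le.
  have mB : forall z, `|z| = 1 -> `|m z| <= \sum_(i < size u) `|u`_i|.
    by move=> z z1; rewrite normrM normfV z1X // invr1 mulr1 normrN horner_norm_le.
  have B0 : 0 <= \sum_(i < size q) `|q`_i| by apply: sumr_ge0.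
  have meanc i : \forall M \near \oo, root_mean M (w0 M) (fun z => L z ^+ i * m z) = - c i.
    exists (maxn (size (- (q ^+ i * u))) (k * i + a).+1) => // M /=.
    rewrite geq_max => /andP[le_M lt_M]; have M0 := leq_ltn_trans (leq0n _) lt_M.
    rewrite -coefN -(root_mean_laurent (prim_w0 _ M0) le_M lt_M).
    apply: (eq_root_mean (prim_w0 _ M0)) => z z1.
    have z0 : z != 0 by rewrite -normr_eq0 z1 oner_eq0.
    rewrite hornerN hornerM horner_exp /L /m expr_div_n -exprM -addnS exprD.
    by field; rewrite !expf_neq0.
  have c0' i : (i0.+1 <= i)%N -> - c i = 0 by move=> /c0 ->; rewrite oppr0.
  apply: climit_eq (climit_mean_resolvent geometric prim_w0 LB mB B0 BN meanc c0').
  exists 1%N => // M /= M0; apply: (eq_root_mean (prim_w0 _ M0)) => z z1.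
  exact: Dg.
rewrite -sumrN; under [RHS]eq_bigr do rewrite -mulrN.
by rewrite -(climit_unique lim1 lim2) coef_map.
Qed.

Let eventual_of_poly (E : fieldExtType (ratfrac C)) (h : nat -> E -> C) :
    (forall (w : {poly {poly C}}) (x : E), \forall N \near \oo,
      h N (map_poly (of_poly E) w).[x] = (map_poly (horner_eval N%:R) w).[h N x]) ->
  forall p, \forall N \near \oo, h N (of_poly E p) = p.[N%:R].
Proof.
move=> hw p; have := hw p%:P 0; apply: filterS => N.
by rewrite !map_polyC !hornerC.
Qed.

(** This lifts [residue_sum_eq] from the values [T = N] to E, after multiplication by [T^(i0+1)] to
    clear negative powers of T. The roots in the disc may vary with N, but there are only finitely
    many subsets I to consider. *)
Lemma residue_sum_in_splitting_field (E : splittingFieldType (ratfrac C))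
    (x : 'I_n -> E) (w v : {poly {poly C}}) :
    'X^k * u^:P = 'X^(a.+1) * w + f * v -> (size w <= n)%N ->
    injective x -> (forall i, (map_poly (of_poly E) f).[x i] = 0) ->
  exists I : {set 'I_n},
    of_poly E 'X^(i0.+1) * \sum_(i in I)
      (map_poly (of_poly E) w).[x i] / (map_poly (of_poly E) f^`()).[x i] =
    - of_poly E ('X^(i0.+1) * v`_a + \sum_(i < i0.+1) c i *: 'X^(i0 - i)).
Proof.
move=> Du size_w x_inj fx.
set r := 'X^(i0.+1) * _ + _.
pose y i := (map_poly (of_poly E) w).[x i] / (map_poly (of_poly E) f^`()).[x i].
(* Otherwise the finitely many elements Z I of E are nonzero, hence specialize to
   nonzero numbers for some N; but the roots in the unit disc at T = N form a
   subset I such that Z I specializes to 0. *)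
apply: contrapT => noI.
pose Z (I : {set 'I_n}) := of_poly E 'X^(i0.+1) * (\sum_(i in I) y i) + of_poly E r.
have Z_neq0 I : Z I != 0.
  by apply: contra_notN noI => ZI0; exists I; apply/eqP; rewrite -addr_eq0.
have [h hP hw] := eventual_specialization E.
have hp := eventual_of_poly hw.
have [hD hM _] := hP.
have df0 i : (map_poly (of_poly E) f^`()).[x i] != 0.
  by have := deriv_level_root_neq0 q0 k_gt0 (@pchar_num C) k_lt (fx i).
have near_Z : \forall N \near \oo, forall I, h N (Z I) != 0.
  by apply: filter_forall => I; apply: eventual_neq0.
have near_hZ : \forall N \near \oo, forall I : {set 'I_n},
    h N (Z I) = N%:R ^+ i0.+1 * (\sum_(i in I) h N (y i)) + r.[N%:R].
  apply: filter_forall => I.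
  have e1 := hD (of_poly E 'X^(i0.+1) * (\sum_(i in I) y i)) (of_poly E r).
  have e2 := hM (of_poly E 'X^(i0.+1)) (\sum_(i in I) y i).
  have e3 := hp 'X^(i0.+1); have e4 := hp r.
  have e5 := eventual_sum hP (index_enum _) (fun i => i \in I) y.
  apply: filterS (filterI (filterI e1 e2) (filterI e3 (filterI e4 e5))) => N.
  move=> [[E1 E2] [E3 [E4 E5]]].
  by rewrite /Z E1 E2 E3 E4 E5 hornerXn.
have near_y : \forall N \near \oo, forall i,
    h N (y i) * (map_poly (horner_eval N%:R) f^`()).[h N (x i)] =
    (map_poly (horner_eval N%:R) w).[h N (x i)].
  apply: filter_forall => i.
  have e1 := hM (y i) (map_poly (of_poly E) f^`()).[x i].
  move: e1 (hw f^`() (x i)) (hw w (x i)); apply: filterS3 => N e1 <- <-.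
  by rewrite -e1 /y divfK.
have near_x : \forall N \near \oo, forall i, (fN N%:R).[h N (x i)] = 0.
  apply: filter_forall => i; have := hw f (x i); rewrite fx.
  by have := eventual0 hP; apply: filterS2 => N -> <-.
have near_inj : \forall N \near \oo, forall i j, i != j -> h N (x i) != h N (x j).
  apply: filter_forall => i; apply: filter_forall => j.
  have [->|ij] := eqVneq i j; first exact: nearW.
  have xij : x i - x j != 0 by rewrite subr_eq0 (inj_eq x_inj).
  move: (eventual_neq0 hP xij) (eventualB hP (x i) (x j)); apply: filterS2 => N.
  by move=> hij hB _; rewrite -subr_eq0 -hB.
have near_B : \forall N \near \oo, \sum_(i < size q) `|q`_i| < N%:R.
  by apply: archimedean; apply: sumr_ge0.
have [N [[NZ NhZ] [Ny [Nx [Ninj NB]]]]] := filter_ex (filterI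
  (filterI near_Z near_hZ) (filterI near_y (filterI near_x (filterI near_inj near_B)))).
have hx_inj : injective (fun i => h N (x i)).
  by move=> i j /eqP; apply: contraTeq => /Ninj.
have := residue_sum_eq Du size_w hx_inj Nx NB.
set I := [set i | _]%SET => DI.
have N0 : N%:R != 0 :> C by rewrite gt_eqF // (le_lt_trans _ NB) // sumr_ge0.
case/negP: (NZ I); rewrite NhZ.
have -> : \sum_(i in I) h N (y i) = - \sum_(i < i0.+1) N%:R ^- i.+1 * c i - (v`_a).[N%:R].
  rewrite -DI addrK; apply: eq_bigr => i _; rewrite -Ny deriv_map mulfK //.
  by rewrite -deriv_map; apply: (deriv_root_neq0 hx_inj Nx (size_fN _)).
rewrite /r hornerD hornerM hornerXn horner_sum mulrBr mulrN addrA subrK addrC mulr_sumr.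
rewrite subr_eq0; apply/eqP; apply: eq_bigr => i _; rewrite hornerZ hornerXn.
have le_i : (i <= i0)%N by rewrite -ltnS.
have -> : N%:R ^+ i0.+1 = N%:R ^+ i.+1 * N%:R ^+ (i0 - i) :> C.
  by rewrite -exprD addSn subnKC.
by field; rewrite expf_neq0.
Qed.

Lemma pole_coef_eq0 : u`_a = 0.
Proof.
have [E [x [x_inj fx conj_x]]] := level_splitting (@pchar_num C) q0 k_gt0 k_lt.
have q_neq0 : q != 0 by apply: contraNneq q0 => ->; rewrite coef0.
have lead_f : lead_coef f = (lead_coef q)%:P by apply: lead_coef_level_poly.
have size_f : size f = n.+1.
  by rewrite size_level_poly // /n prednK //; case: (size q) k_lt.
have lead_unit : lead_coef f \is a GRing.unit.
  by rewrite lead_f poly_unitE size_polyC lead_coef_eq0 q_neq0 coefC unitfE lead_coef_eq0.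
have f0_unit : f`_0 \is a GRing.unit.
  rewrite /f /level_poly coefB coef_map coefCM coefXn ltn_eqF // mulr0 subr0.
  by rewrite poly_unitE size_polyC q0 coefC unitfE.
have [w [v [size_w Du]]] := reduce_modulo ('X^k * u^:P) a.+1 lead_unit f0_unit.
rewrite size_f ltnS in size_w.
have [I DI] := residue_sum_in_splitting_field Du size_w x_inj fx.
set y := (fun i => (map_poly (of_poly E) w).[x i] / (map_poly (of_poly E) f^`()).[x i]) in DI.
rewrite -/(y _) in DI.
set r := 'X^(i0.+1) * _ + _ in DI.
have XE : of_poly E 'X^(i0.+1) != 0 by rewrite of_poly_eq0 -size_poly_eq0 size_polyXn.
(* The full sum of the y i is a polynomial in T. *)
have sum_y : \sum_i y i = of_poly E (w`_n.-1 * ((lead_coef q)^-1)%:P).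
  have lead_fE : of_poly E (lead_coef f) != 0.
    by rewrite of_poly_eq0 lead_coef_eq0 -size_poly_eq0 size_f.
  have size_fE : size (map_poly (of_poly E) f) = n.+1 by rewrite size_map_poly_id0.
  have size_wE : (size (map_poly (of_poly E) w) <= n)%N.
    exact: leq_trans (size_poly _ _) size_w.
  rewrite /y; under eq_bigr do rewrite -deriv_map.
  rewrite (sum_residues x_inj fx size_fE size_wE) coef_map rmorphM /=; congr (_ * _).
  rewrite lead_coef_map_id0 ?rmorph0 //; apply: (mulfI lead_fE); rewrite divff //.
  by rewrite lead_f -rmorphM -polyCM divff ?lead_coef_eq0 // rmorph1.
have conj_y i j : exists2 s, s \in 'Gal({:E} / 1)%g & s (y i) = y j.
  have [s Gs sx] := conj_x i j; exists s => //.
  by rewrite /y fmorph_div /= !gal_horner sx.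
have of_poly1 p : of_poly E p \in 1%VS by rewrite /of_poly /= memvZ ?mem1v.
have sumI1 : \sum_(i in I) y i \in 1%VS.
  have -> : \sum_(i in I) y i = - of_poly E r / of_poly E 'X^(i0.+1).
    by rewrite -DI mulrAC divff ?mul1r.
  by rewrite rpred_div // rpredN.
have sum1 : \sum_i y i \in 1%VS by rewrite sum_y.
have := conjugate_sum_average (@pchar_ratfrac C) conj_y sumI1 sum1.
move/(congr1 (fun z => of_poly E 'X^(i0.+1) * z)).
rewrite mulrnAr DI mulrnAr sum_y -rmorphN -rmorphM -!rmorphMn => /eqP.
(* Take the coefficient of [T^i0]. Multiples of [T^(i0+1)] do not contribute, which removes the
   right-hand side and the term in [v_a]; among the [c i T^(i0-i)] only [i = 0] remains, and [c 0]
   is [u_a]. *)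
rewrite -subr_eq0 -rmorphB of_poly_eq0 subr_eq0 => /eqP /(congr1 (fun p : {poly C} => p`_i0)).
rewrite !coefMn coefXnM ltnSn mul0rn coefN coefD coefXnM ltnSn add0r.
rewrite coef_sum (bigD1 ord0) //= big1 => [|i i_neq0].
  rewrite subn0 coefZ coefXn eqxx mulr1 addr0 => /eqP.
  rewrite -mulr_natr mulf_eq0 oppr_eq0 pnatr_eq0 /c expr0 mul1r muln0 add0n.
  by rewrite (gtn_eqF (leq_ltn_trans (leq0n k) k_lt)) orbF => /eqP.
rewrite coefZ coefXn; case: eqVneq => [Di|]; last by rewrite mulr0.
case/eqP: i_neq0; apply: val_inj => /=.
have := subnK (ltn_ord i : (i <= i0)%N); rewrite -Di => /eqP.
by rewrite -[X in _ == X]addn0 eqn_add2l => /eqP.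
Qed.

End Core.

(** * Contour integrals and Laurent polynomials *)

Section CircleIntegral.
Variable R : realType.

Lemma Rintegral_antiderivative (F f : R -> R) (a b : R) : a < b ->
    (forall t : R, is_derive t 1 F (f t)) -> continuous f ->
  Rintegral (@lebesgue_measure R) `[a, b] f = F b - F a.
Proof.
move=> ab dF cf; rewrite /Rintegral (@continuous_FTC2 _ f F) //.
- exact: continuous_subspaceT.
- have cF : continuous F.
    by move=> t; apply/differentiable_continuous/derivable1_diffP; have [] := dF t.
  split; first by move=> t _; have [] := dF t.
    exact/cvg_at_right_filter/cF.
  exact/cvg_at_left_filter/cF.
- by move=> t _; rewrite derive1E; have [_ ->] := dF t.
Qed.

Lemma expiD (s t : R) : expi (s + t) = expi s * expi t.
Proof.
rewrite /expi cosD sinD; simpc; congr (_ +i* _)%C; ring.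
Qed.

Lemma norm_expi (t : R) : `|expi t| = 1.
Proof. by rewrite normc_def /= cos2Dsin2 sqrtr1. Qed.

Lemma expi_neq0 (t : R) : expi t != 0.
Proof. by rewrite -normr_eq0 norm_expi oner_eq0. Qed.

Lemma expi_nat (n : nat) (t : R) : expi (n%:R * t) = expi t ^+ n.
Proof.
elim: n => [|n IHn]; first by rewrite mul0r /expi cos0 sin0.
by rewrite mulrS mulrDl mul1r expiD IHn exprS.
Qed.

(** The frequency is a difference of naturals because the integrand below is a polynomial divided by
    a power of z. *)
Lemma expi_int (s a : nat) (t : R) :
  expi ((s%:Z - a%:Z)%:~R * t) = expi t ^+ s / expi t ^+ a.
Proof.
have ea : expi t ^+ a != 0 by rewrite expf_neq0 ?expi_neq0.
apply: (mulIf ea); rewrite mulfVK // -!expi_nat -expiD -mulrDl.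
by rewrite rmorphB /= subrK.
Qed.

Lemma expi_2pi (r : int) : expi (r%:~R * (pi *+ 2)) = 1 :> R[i].
Proof.
have e2pi : expi (pi *+ 2) = 1 :> R[i] by rewrite /expi cos2pi sin2pi.
case: r => n; last rewrite NegzE -[- _]sub0r.
  by rewrite -[Posz n]subr0 (expi_int n 0) e2pi !expr1n divr1.
by rewrite (expi_int 0 n.+1) e2pi !expr1n divr1.
Qed.

(** Terms of nonzero frequency have a primitive of period 2 pi and integrate to 0; those of
    frequency 0 are constant. *)
Lemma trigonometric_integral n (r : 'I_n -> int) (c d : 'I_n -> R) :
  Rintegral (@lebesgue_measure R) `[0, pi *+ 2]
    (fun t => \sum_i (c i * cos ((r i)%:~R * t) + d i * sin ((r i)%:~R * t))) =
  pi *+ 2 * \sum_(i | r i == 0) c i.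
Proof.
pose rot i : R -> R := (r i)%:~R \*: (@id R).
have drot i (t : R) : is_derive t 1 (rot i) (r i)%:~R.
  by apply: is_derive_eq (is_deriveZ _ _) _; rewrite [LHS]mulr1.
(* Function combinators replace explicit lambdas here so that derivatives are found by instance
   inference. *)
pose f i : R -> R := (c i \*: (cos \o rot i)) + (d i \*: (sin \o rot i)).
pose F i : R -> R := if r i == 0 then c i \*: (@id R)
  else ((c i / (r i)%:~R) \*: (sin \o rot i)) - ((d i / (r i)%:~R) \*: (cos \o rot i)).
have fE i t : f i t = c i * cos ((r i)%:~R * t) + d i * sin ((r i)%:~R * t) by [].
have FE i t : F i t = if r i == 0 then c i * t else
    c i / (r i)%:~R * sin ((r i)%:~R * t) - d i / (r i)%:~R * cos ((r i)%:~R * t).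
  by rewrite /F; case: ifP.
have dF i (t : R) : is_derive t 1 (F i) (f i t).
  rewrite fE /F; case: eqVneq => ri0.
    apply: is_derive_eq (is_deriveZ _ _) _; rewrite [LHS]mulr1.
    by rewrite ri0 mul0r cos0 sin0; ring.
  have r0 : (r i)%:~R != 0 :> R by rewrite intr_eq0.
  apply: is_derive_eq.
  rewrite /rot /= /GRing.scale /=.
  by field.
have df i (t : R) : derivable (f i) t 1 by apply: ex_derive.
have sumE (G : 'I_n -> R -> R) : \sum_i G i = (fun t => \sum_i G i t).
  by apply/funext => t; rewrite fct_sumE.
have dS (t : R) : is_derive t 1 (\sum_i F i) ((\sum_i f i) t).
  have <- : \sum_i f i t = (\sum_i f i) t by rewrite fct_sumE.
  exact: is_derive_sum.
have cS : continuous (\sum_i f i).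
  move=> t; apply/differentiable_continuous/derivable1_diffP.
  by apply: derivable_sum => i; apply: df.
have pi2_gt0 : 0 < pi *+ 2 :> R by rewrite mulrn_wgt0 // pi_gt0.
rewrite (_ : (fun t => _) = \sum_i f i); last by rewrite sumE.
rewrite (Rintegral_antiderivative pi2_gt0 dS cS).
rewrite !sumE -sumrB mulr_sumr [RHS]big_mkcond; apply: eq_bigr => i _; rewrite !FE.
case: ifP => _; first by rewrite mulr0 subr0 mulrC.
have [-> ->] : cos ((r i)%:~R * (pi *+ 2)) = 1 :> R /\ sin ((r i)%:~R * (pi *+ 2)) = 0 :> R.
  by have [] := expi_2pi (r i).
by rewrite !mulr0 cos0 sin0; ring.
Qed.

(** Both components are trigonometric sums of frequencies [s - a], so only the coefficient of index
    a contributes. *)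
Lemma circle_integral_laurent (p : {poly R[i]}) (a : nat) :
  circle_integral (fun z => p.[z] / z ^+ a.+1) = (pi *+ 2)%:C%C * 'i%C * p`_a.
Proof.
pose r (s : 'I_(maxn (size p) a.+1)) : int := s%:Z - a%:Z.
have lt_a : (a < maxn (size p) a.+1)%N by rewrite leq_maxr.
have sum_r (G : nat -> R) : \sum_(s | r s == 0) G s = G a.
  rewrite (big_pred1 (Ordinal lt_a)) // => s.
  by rewrite /= /r subr_eq0 eqz_nat.
have Dg t : p.[expi t] / expi t ^+ a.+1 * ('i%C * expi t) =
    \sum_(s < maxn (size p) a.+1) ('i%C * p`_s) * expi ((r s)%:~R * t).
  rewrite (horner_coef_wide _ (leq_maxl _ a.+1)) exprS invfM.
  rewrite (_ : _ * _ * _ =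
      'i%C * (\sum_(i < maxn (size p) a.+1) p`_i * expi t ^+ i) / expi t ^+ a).
    rewrite mulr_sumr mulr_suml; apply: eq_bigr => s _.
    by rewrite expi_int; ring.
  by field; rewrite expf_neq0 ?expi_neq0.
rewrite /circle_integral.
have DRe t : complex.Re (p.[expi t] / expi t ^+ a.+1 * ('i%C * expi t)) =
    \sum_(s < maxn (size p) a.+1)
      (- complex.Im (p`_s) * cos ((r s)%:~R * t) + - complex.Re (p`_s) * sin ((r s)%:~R * t)).
  rewrite Dg raddf_sum; apply: eq_bigr => s _ /=.
  by case: (p`_s) => x y /=; simpc; rewrite /=; ring.
have DIm t : complex.Im (p.[expi t] / expi t ^+ a.+1 * ('i%C * expi t)) =
    \sum_(s < maxn (size p) a.+1)
      (complex.Re (p`_s) * cos ((r s)%:~R * t) + - complex.Im (p`_s) * sin ((r s)%:~R * t)).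
  rewrite Dg raddf_sum; apply: eq_bigr => s _ /=.
  by case: (p`_s) => x y /=; simpc; rewrite /=; ring.
under eq_Rintegral do rewrite DRe.
under [in X in (_ +i* X)%C]eq_Rintegral do rewrite DIm.
rewrite !trigonometric_integral.
rewrite (sum_r (fun s => - complex.Im (p`_s))) (sum_r (fun s => complex.Re (p`_s))).
by case: (p`_a) => x y /=; simpc; congr (_ +i* _)%C; ring.
Qed.
End CircleIntegral.

Section ComplexArchimedean.
Variable R : realType.

(** Comparison with 0 in [R[i]] forces the imaginary part to vanish, which reduces the claim to
    R. *)
Lemma complex_geometric (x : R[i]) : 0 <= x < 1 -> forall e, 0 < e ->
  \forall M \near \oo, x ^+ M < e.
Proof.
case: x => a b; rewrite lecE ltcE /= => /andP[/andP[/eqP -> a0] /andP[_ a1]].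
case=> c d; rewrite ltcE /= => /andP[/eqP -> c0].
have na1 : `|a| < 1 by rewrite ger0_norm.
have [N _ HN] := cvgr_lt _ (cvg_expr na1) _ c0.
exists N => // M NM; have := HN _ NM.
by rewrite -(rmorphXn (real_complex R)) ltcR.
Qed.

Lemma complex_archimedean (B : R[i]) : 0 <= B -> \forall N \near \oo, B < N%:R.
Proof.
case: B => b d; rewrite lecE /= => /andP[/eqP -> b0].
exists (Num.bound b) => // N /= le_N; rewrite -(rmorph_nat (real_complex R)) ltcR.
by apply: lt_le_trans (archi_boundP b0) _; rewrite ler_nat.
Qed.
End ComplexArchimedean.

(** * Laurent polynomials as shifted polynomials *)

Section Laurent.
Variables (R : realType) (L : laurent R).

(** This represents [z^d L] when d is at least the order of the pole at 0; otherwise [absz] would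
    fold negative exponents, whence the condition on d in the lemmas below. *)
Definition shift_poly (d : nat) : {poly R[i]} :=
  \sum_(n <- finsupp L) L n *: 'X^(absz (n + d%:Z)).

Lemma laurent_eval_shift d : (forall n, n \in finsupp L -> 0 <= n + d%:Z) ->
  forall z, z != 0 -> laurent_eval L z = (shift_poly d).[z] / z ^+ d.
Proof.
move=> Ld z z0; rewrite /laurent_eval /shift_poly horner_sum mulr_suml.
rewrite !big_seq; apply: eq_bigr => n /Ld nd.
rewrite hornerZ hornerXn -mulrA; congr (_ * _).
have zd : z ^+ d != 0 by rewrite expf_neq0.
by apply: (mulIf zd); rewrite divfK // !exprnP gez0_abs // expfzDr.
Qed.

Lemma coef_shift_poly d (j : nat) : (forall n, n \in finsupp L -> 0 <= n + d%:Z) ->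
  (shift_poly d)`_j = L (j%:Z - d%:Z).
Proof.
move=> Ld; rewrite /shift_poly coef_sum.
have coefE n : n \in finsupp L -> (L n *: 'X^(absz (n + d%:Z)))`_j =
    if n == j%:Z - d%:Z then L n else 0.
  move=> /Ld nd; rewrite coefZ coefXn -eqz_nat gez0_abs // eq_sym.
  by rewrite -subr_eq opprK; case: eqP; rewrite ?mulr1 ?mulr0.
rewrite big_seq (eq_bigr _ coefE) -big_seq.
have [Lj|nLj] := boolP (j%:Z - d%:Z \in finsupp L).
  by rewrite (bigD1_seq _ Lj) ?fset_uniq //= eqxx big1 ?addr0 // => n /negPf ->.
rewrite (fsfun_dflt nLj) big_seq big1 // => n Ln.
by case: eqP => // Dn; rewrite -Dn Ln in nLj.
Qed.
End Laurent.

Unset Implicit Arguments.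

Theorem theorem6p1 (R : realType) (L m : laurent R) (i0 : nat)
    (hm : m (-1) <> 0)
    (hint : forall i : nat, (i0 <= i)%N ->
      circle_integral
        (fun z => laurent_eval L z ^+ i * laurent_eval m z) = 0) :
  polynomial_in_z L \/ polynomial_in_inv_z L.
Proof.
have [L_ge0|/allPn[n1 Ln1]] := boolP (all (fun n => 0 <= n) (finsupp L)).
  left; exists (shift_poly L 0) => z z0.
  rewrite (@laurent_eval_shift _ _ 0) // ?expr0 ?divr1 // => n Ln.
  by rewrite addr0 (allP L_ge0).
rewrite -ltNge => n1_lt0.
have [L_le0|/allPn[n2 Ln2]] := boolP (all (fun n => n <= 0) (finsupp L)).
  right; exists (\sum_(n <- finsupp L) L n *: 'X^(absz n)) => z z0.
  rewrite /laurent_eval horner_sum !big_seq; apply: eq_bigr => n /(allP L_le0) n_le0.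
  by rewrite hornerZ hornerXn exprVn exprnN -abszN gez0_abs ?oppr_ge0 ?opprK.
rewrite -ltNge => n2_gt0; exfalso; apply: hm.
(* k is the order of the pole of L at 0, the largest k with [-k] in the support; it exists as L has
   the negative exponent [n1]. *)
have [k Lk k_max] : exists2 k : nat, - k%:Z \in finsupp L &
    forall n, n \in finsupp L -> 0 <= n + k%:Z.
  pose P k := - k%:Z \in finsupp L.
  have exP : exists k, P k by exists (absz n1); rewrite /P ltz0_abs ?opprK.
  have ubP k : P k -> (k <= \sum_(n <- finsupp L) absz n)%N.
    by move=> Pk; rewrite (big_rem _ Pk) /= abszN absz_nat leq_addr.
  case: (ex_maxnP exP ubP) => k Pk max_k; exists k => // n Ln.
  have [n_ge0|n_lt0] := leP 0 n; first by rewrite addr_ge0.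
  have Dn : n = - (absz n)%:Z by rewrite ltz0_abs ?opprK.
  have /max_k : P (absz n) by rewrite /P -Dn.
  by rewrite {2}Dn addrC subr_ge0 lez_nat.
(* Any bound on the pole of m serves; in the form [a.+1] it places the coefficient of 1/z at index a
   of u. *)
have [a m_a] : exists a, forall n, n \in finsupp m -> 0 <= n + a.+1%:Z.
  exists (\sum_(n <- finsupp m) absz n)%N => n mn.
  have : (absz n <= \sum_(n <- finsupp m) absz n)%N by rewrite (big_rem _ mn) /= leq_addr.
  lia.
pose q := shift_poly L k; pose u := shift_poly m a.+1.
have k_gt0 : (0 < k)%N by have := k_max _ Ln1; lia.
have q0 : q`_0 != 0 by rewrite coef_shift_poly // sub0r -mem_finsupp.
(* The positive exponent [n2] of L gives q a nonzero coefficient of degree [k + n2], beyond k. *)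
have k_lt : (k < (size q).-1)%N.
  have : q`_(k + absz n2) != 0.
    rewrite coef_shift_poly // (_ : _ - _ = n2) -?mem_finsupp //; lia.
  move=> qn2; have : (k + absz n2 < size q)%N.
    by rewrite ltnNge; apply: contra qn2 => /(nth_default 0) ->.
  lia.
have ua : u`_a = m (-1).
  by rewrite coef_shift_poly //; congr (m _); lia.
rewrite -ua.
apply: (@pole_coef_eq0 _ (@complex_geometric R) (@complex_archimedean R) q u k a i0) => //.
move=> i lt_i; have := hint i (ltnW lt_i).
rewrite (_ : circle_integral _ = circle_integral
    (fun z => (q ^+ i * u).[z] / z ^+ (k * i + a).+1)); last first.
  (* The two integrands need to agree only on the circle, where z is nonzero and dividing by its
     powers is legitimate. *)
  have eq_z t : laurent_eval L (expi t) ^+ i * laurent_eval m (expi t) =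
      (q ^+ i * u).[expi t] / expi t ^+ (k * i + a).+1.
    have e0 := expi_neq0 t.
    rewrite (@laurent_eval_shift _ _ _ k_max) // (@laurent_eval_shift _ _ _ m_a) //.
    rewrite -/q -/u hornerM horner_exp expr_div_n -exprM -addnS exprD.
    by field; rewrite !expf_neq0.
  rewrite /circle_integral.
  by congr (_ +i* _)%C; apply: eq_Rintegral => t _; rewrite eq_z.
rewrite circle_integral_laurent => /eqP; rewrite !mulf_eq0 => /orP[/orP[]|/eqP //].
  by rewrite eq_complex /= eqxx andbT mulrn_eq0 /= gt_eqF // pi_gt0.
by rewrite eq_complex /= oner_eq0 andbF.
Qed.
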